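(* There is an algorithm that, given an acyclic digraph $G$ and a vertex weighting $\mathbf{a}: V(G) \to \mathbb{R}$, correctly computes the weighted reachability number $r_{G,\mathbf{a}}(v) = \sum_{u \in R_G(v)} a_u$ for every vertex $v \in V(G)$. It runs in $\mathcal{O}(f^3 n + f^2 m)$ time and $\mathcal{O}(fn + m)$ space, where $n = |V(G)|$, $m = |E(G)|$, and $f$ is the feedback edge number of $G$.
   Context: All digraphs are simple: no self-loops and no multi-edges, though both $(u,v)$ and $(v,u)$ may be present. For a digraph $G$ and a vertex $v$, the reachability set $R_G(v)$ is the set of vertices reachable from $v$ by a directed path in $G$, including $v$ itself. A feedback edge set of a digraph is a set of edges whose deletion leaves a digraph whose underlying undirected multigraph is a forest. The feedback edge number is the minimum size of a feedback edge set. It equals $|E(G)|-|V(G)|+c$, where $c$ is the number of weakly connected components of $G$.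
   Formalization: The bounds are read with f replaced by max(f,1) and 1 added, since the literal time bound is 0 on every forest (f = 0) and the space bound is 0 on edgeless graphs; for f ≥ 1 they agree with the stated bounds up to a constant factor. *)

(* Defs.v *)
From mathcomp Require Import all_boot all_order all_algebra.

Set Implicit Arguments.
Unset Strict Implicit.
Unset Printing Implicit Defensive.

Import GRing.Theory.

Record digraph (V : finType) := Digraph {
  arc : rel V;
  arc_irrefl : irreflexive arc
}.

Section Digraphs.
Variables (V : finType) (G : digraph V).

Definition edges : {set V * V} := [set e | arc G e.1 e.2].

Definition acyclic : Prop := forall c : seq V, cycle (arc G) c -> c = [::].

Definition reach (v : V) : {set V} := [set u | connect (arc G) v u].

End Digraphs.

(* Cycles of the underlying undirected multigraph of an edge set.  A dart is
   an edge together with a direction of traversal (true = forwards).  A cycle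
   is a nonempty cyclic sequence of darts, each starting where the previous one
   ends, that repeats neither a vertex nor an edge.  Two opposite edges (u, v)
   and (v, u) are parallel in the multigraph and form a cycle of length 2. *)
Section Multigraph.
Variable V : finType.

Definition dart : Type := (V * V) * bool.
Definition dart_src (d : dart) : V := if d.2 then d.1.1 else d.1.2.
Definition dart_tgt (d : dart) : V := if d.2 then d.1.2 else d.1.1.

Definition undirected_cycle (F : {set V * V}) (ds : seq dart) : bool :=
  [&& ds != [::], all (fun d : dart => d.1 \in F) ds,
      cycle (fun d d' : dart => dart_tgt d == dart_src d') ds,
      uniq (map fst ds) & uniq (map dart_src ds)].

Definition forest (F : {set V * V}) : Prop :=
  forall ds : seq dart, ~~ undirected_cycle F ds.

Definition feedback_edge_set (G : digraph V) (S : {set V * V}) : Prop :=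
  S \subset edges G /\ forest (edges G :\: S).

Definition is_feedback_edge_number (G : digraph V) (f : nat) : Prop :=
  (exists2 S, feedback_edge_set G S & #|S| = f) /\
  (forall S, feedback_edge_set G S -> f <= #|S|).

End Multigraph.

(* The model of computation is a random access machine with an integer memory
   and a separate memory for weights, programmed by while-programs.  Integer
   cells hold machine words: a computed value that does not fit in a word is a
   fault.  Weights can only be copied, added and subtracted, and nothing flows
   from the weight memory to the integer memory, so nothing can be encoded in
   the weights. *)

(* Sub is truncated; Div and Mod are those of ssrnat's %/ and %%;
   Lt and Eq return 0 or 1. *)
Variant binop := Add | Sub | Mul | Div | Mod | Lt | Eq.

Definition binop_eval (o : binop) (x y : nat) : nat :=
  match o with
  | Add => x + y
  | Sub => x - y
  | Mul => x * y
  | Div => x %/ y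
  | Mod => x %% y
  | Lt => x < y
  | Eq => x == y
  end.

Inductive expr :=
  | Cst of nat
  | Read of expr
  | Bin of binop & expr & expr.

Inductive wexpr :=
  | WZero
  | WRead of expr
  | WAdd of wexpr & wexpr
  | WSub of wexpr & wexpr.

Inductive cmd :=
  | Skip
  | Store of expr & expr
  | WStore of expr & wexpr
  | Seq of cmd & cmd
  | If of expr & cmd & cmd
  | While of expr & cmd.

(* The time taken by an expression is the number of operations in it. *)
Fixpoint expr_time (e : expr) : nat :=
  match e with
  | Cst _ => 1
  | Read e1 => (expr_time e1).+1
  | Bin _ e1 e2 => (expr_time e1 + expr_time e2).+1
  end.

Fixpoint wexpr_time (r : wexpr) : nat :=
  match r with
  | WZero => 1
  | WRead e => (expr_time e).+1
  | WAdd r1 r2 | WSub r1 r2 => (wexpr_time r1 + wexpr_time r2).+1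
  end.

Section Semantics.
Variable R : zmodType.

Record state := State {
  imem : nat -> nat;
  wmem : nat -> R
}.

(* Words are the naturals below W, and each of the two memories consists of
   the S cells with addresses below S; None is a fault. *)
Variables W S : nat.

Definition guard (T : Type) (b : bool) (x : T) : option T :=
  if b then Some x else None.

Fixpoint expr_eval (s : state) (e : expr) : option nat :=
  match e with
  | Cst c => guard (c < W) c
  | Read e1 => obind (fun i => guard (i < S) (imem s i)) (expr_eval s e1)
  | Bin o e1 e2 =>
      obind (fun x => obind (fun y =>
        guard (binop_eval o x y < W) (binop_eval o x y))
        (expr_eval s e2)) (expr_eval s e1)
  end.

Fixpoint wexpr_eval (s : state) (r : wexpr) : option R :=
  match r with
  | WZero => Some 0%R
  | WRead e => obind (fun i => guard (i < S) (wmem s i)) (expr_eval s e)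
  | WAdd r1 r2 =>
      obind (fun x => obind (fun y => Some (x + y)%R)
        (wexpr_eval s r2)) (wexpr_eval s r1)
  | WSub r1 r2 =>
      obind (fun x => obind (fun y => Some (x - y)%R)
        (wexpr_eval s r2)) (wexpr_eval s r1)
  end.

(* exec c s t s': started in s, c halts without fault in s' after time t. *)
Inductive exec : cmd -> state -> nat -> state -> Prop :=
  | ExecSkip s : exec Skip s 1 s
  | ExecStore s e1 e2 i x :
      expr_eval s e1 = Some i -> i < S -> expr_eval s e2 = Some x ->
      exec (Store e1 e2) s (expr_time e1 + expr_time e2).+1
        (State [eta imem s with i |-> x] (wmem s))
  | ExecWStore s e r i x :
      expr_eval s e = Some i -> i < S -> wexpr_eval s r = Some x ->
      exec (WStore e r) s (expr_time e + wexpr_time r).+1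
        (State (imem s) [eta wmem s with i |-> x])
  | ExecSeq c1 c2 s1 t1 s2 t2 s3 :
      exec c1 s1 t1 s2 -> exec c2 s2 t2 s3 ->
      exec (Seq c1 c2) s1 (t1 + t2) s3
  | ExecIf e c1 c2 x s t s' :
      expr_eval s e = Some x -> exec (if x != 0 then c1 else c2) s t s' ->
      exec (If e c1 c2) s (expr_time e + t).+1 s'
  | ExecWhileDone e c s :
      expr_eval s e = Some 0 -> exec (While e c) s (expr_time e).+1 s
  | ExecWhileStep e c x s1 t1 s2 t2 s3 :
      expr_eval s1 e = Some x -> x != 0 ->
      exec c s1 t1 s2 -> exec (While e c) s2 t2 s3 ->
      exec (While e c) s1 (expr_time e + t1 + t2).+1 s3.

(* The integer memory initially holds n, the number of edges, and then the
   endpoints of the edges in the order of es, followed by zeros; the weight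
   memory holds the n vertex weights, followed by zeros. *)
Definition input (n : nat) (es : seq ('I_n * 'I_n)) (a : 'I_n -> R) : state :=
  State
    (nth 0 (n :: size es :: flatten [seq [:: val e.1; val e.2] | e <- es]))
    (nth 0%R [seq a v | v <- enum 'I_n]).

End Semantics.

Definition edge_listing (n : nat) (G : digraph 'I_n)
  (es : seq ('I_n * 'I_n)) : Prop := perm_eq es (enum (edges G)).

(* The bounds O(f^3 n + f^2 m) and O(f n + m), made meaningful in the
   degenerate cases: they vanish on an edgeless graph, and the first one on
   every forest, where an algorithm still has to produce its output.  So f = 0
   is read as f = 1, and 1 is added for the graph without vertices.  For
   f >= 1 they agree with the displayed bounds up to a factor of 2. *)
Definition time_bound (f n m : nat) : nat :=
  maxn f 1 ^ 3 * n + maxn f 1 ^ 2 * m + 1.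
Definition space_bound (f n m : nat) : nat := maxn f 1 * n + m + 1.

(* Main.v *)
Require Import Defs.
From HB Require Import structures.
From mathcomp Require Import all_boot all_order all_algebra.
From mathcomp Require Import reals.
From mathcomp Require Import zify.

(* Call a vertex bad if the reachability sets of two of its out-neighbours
   meet.  At a vertex v that is not bad, r(v) is a_v plus the sum of r over the
   out-neighbours, so a sweep in reverse topological order computes r once the
   values at the bad vertices are known, and those are found by one graph search
   each.  The bad vertices are among the suspects of the following procedure,
   which takes linear time: peel off leaves of the underlying undirected graph
   until none is left, then go through the edges sorted topologically by tail,
   delete each edge still present, mark its tail as suspect, and peel again.  If
   v is bad, the paths from v to a first meeting point form a subgraph without
   leaves, which no peeling touches, so the first of its edges to go is a
   deleted one, and by the order its tail is v.  There are at most 3f suspects: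
   the quantity sum_v max(deg v - 2, 0) + #(surviving feedback edges) is at most
   3f on a graph without leaves, and every deletion followed by peeling lowers
   it.  The total time is O((f + 1)(n + m)). *)

Set Implicit Arguments.
Unset Strict Implicit.
Unset Printing Implicit Defensive.

(** The obstacle is that badness cannot be tested at a vertex within the time allowed. A feedback
    edge set occurs only in the count of suspects; the program never computes one. Leafless
    subgraphs link the two sides: meeting paths contain one, peeling cannot destroy one, and a
    nonempty one contains a cycle, hence a feedback edge. A search is one pass over the sorted edge
    list, because all edges into a vertex precede the edges out of it. Running time is handled by
    budgets: every edge still present carries a credit of 7 commands, and these credits pay for all
    peelings together, however they are distributed over the cuts. *)

Local Notation arc := Defs.arc.

(** * Leafless subgraphs and forests *)

Section Incidence.
Variable V : finType.
Implicit Types (v : V) (e : V * V) (A C D F S : {set V * V}).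

Definition incident v e : bool := (e.1 == v) || (e.2 == v).

Definition other v e : V := if e.1 == v then e.2 else e.1.

Definition deg A v : nat := \sum_(e in A) incident v e.

Definition loopless A : Prop := forall e, e \in A -> e.1 != e.2.

Definition leafless A : bool :=
  [forall v, forall (e | (e \in A) && incident v e),
     exists e', [&& e' \in A, incident v e' & e' != e]].

(** The condition [leafless] restated by degrees: the program keeps degree counters, whereas
    arguments about subgraphs work with a second edge as witness. *)
Definition core A : Prop := forall v, deg A v != 1.

Lemma leaflessP A :
  reflect (forall v e, e \in A -> incident v e ->
             exists e', [/\ e' \in A, incident v e' & e' != e])
          (leafless A).
Proof.
apply: (iffP forallP) => [H v e eA ve | H v].
  by have /forall_inP/(_ e) := H v; rewrite eA ve => /(_ isT)/existsP[e' /and3P[]]; exists e'.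
apply/forall_inP => e /andP[eA ve]; apply/existsP.
by have [e' [h1 h2 h3]] := H v e eA ve; exists e'; rewrite h1 h2 h3.
Qed.

Lemma forestS F F' : F' \subset F -> forest F -> forest F'.
Proof.
move=> /subsetP sF forF ds; apply: contra (forF ds) => /and5P[h1 h2 h3 h4 h5].
by apply/and5P; split=> //; apply: sub_all h2 => d; apply: sF.
Qed.

Definition chained : rel (dart V) := fun d d' => dart_tgt d == dart_src d'.

Lemma chain_verts d q : path chained d q ->
  dart_src d :: map (@dart_tgt V) (d :: q) =
  rcons (map (@dart_src V) (d :: q)) (dart_tgt (last d q)).
Proof.
elim: q d => [|d' q IH] d //= /andP[/eqP-> /IH].
by move=> [->].
Qed.

Definition trail C (ds : seq (dart V)) : bool :=
  if ds is d :: q then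
    [&& all (fun d : dart V => d.1 \in C) ds, path chained d q, uniq (map fst ds)
      & uniq (dart_src d :: map (@dart_tgt V) ds)]
  else false.

Lemma incident_dart (d : dart V) v :
  incident v d.1 = (v == dart_src d) || (v == dart_tgt d).
Proof.
rewrite /incident /dart_src /dart_tgt ![v == _]eq_sym.
by case: d.2; rewrite // orbC.
Qed.

(* A trail is extended at its front; it is cut off at the point where it meets
   itself. *)
Lemma trail_extend C d q : loopless C -> leafless C -> trail C (d :: q) ->
  (exists ds, undirected_cycle C ds) \/ exists d', trail C (d' :: d :: q).
Proof.
move=> noloop /leaflessP ll /and4P[allC ch ufst uvert].
have dC : d.1 \in C by case/andP: allC.
have [|e [eC xe ne]] := ll (dart_src d) d.1 dC; first by rewrite incident_dart eqxx.
(* The new edge is directed so as to end where the trail starts. *)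
pose d' : dart V := (e, e.2 == dart_src d).
have tgt' : dart_tgt d' = dart_src d.
  rewrite /dart_tgt /=; case: (eqVneq e.2 (dart_src d)) => // ne2.
  by move: xe; rewrite /incident (negPf ne2) orbF => /eqP.
have neyx : dart_src d' != dart_src d.
  rewrite -tgt'; have := noloop e eC.
  by rewrite /dart_src /dart_tgt /=; case: (e.2 == _); rewrite // eq_sym.
have ye : incident (dart_src d') e by rewrite (incident_dart d') eqxx.
have inV g : g \in d :: q ->
    {subset incident^~ g.1 <= dart_src d :: map (@dart_tgt V) (d :: q)}.
  move=> gq v; rewrite unfold_in incident_dart => /orP[]/eqP->.
    by rewrite chain_verts // mem_rcons inE map_f ?orbT.
  by rewrite inE map_f ?orbT.
case: (boolP (dart_src d' \in map (@dart_tgt V) (d :: q))) => [|ynq]; last first.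
  right; exists d'; rewrite /trail.
  have ynV : dart_src d' \notin dart_src d :: map (@dart_tgt V) (d :: q).
    by rewrite inE negb_or neyx.
  apply/and4P; split.
  - by apply/andP; split.
  - by rewrite /= /chained tgt' eqxx.
  - rewrite map_cons cons_uniq ufst andbT; apply/negP => /mapP[g gq /= eg].
    by case/negP: ynV; apply: inV gq _ _; rewrite -eg unfold_in.
  - by rewrite map_cons tgt' cons_uniq ynV.
case/mapP => g gq yg; left.
have [q1 [q2 [Eq lg]]] : exists q1 q2, q = q1 ++ q2 /\ last d q1 = g.
  by case/splitPl: gq => q1 q2 <-; exists q1, q2.
move: ch allC ufst uvert; rewrite Eq -cat_cons !map_cat cat_path all_cat.
rewrite cat_uniq -cat_cons cat_uniq => /andP[ch _] /andP[allC _] /andP[ufst _].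
move=> /andP[uvert _]; exists [:: d', d & q1]; apply/and5P; split=> //.
- by apply/andP; split.
- rewrite /= rcons_path ch lg /chained tgt' eqxx /=.
  exact/eqP/esym.
(* If the new edge already occurred further along the trail, the trail would return to the start of
   [d]. *)
- rewrite map_cons cons_uniq ufst andbT; apply/negP => /mapP[h hq /= eh].
  move: hq; rewrite inE => /predU1P[hd|hq]; first by rewrite eh hd eqxx in ne.
  have xh : dart_src d \in map (@dart_tgt V) (d :: q1).
    have := incident_dart h (dart_src d); rewrite -eh xe => /esym/orP[]/eqP->.
      have /= [->] := chain_verts ch.
      by rewrite mem_rcons inE map_f ?orbT.
    by rewrite map_f // inE hq orbT.
  by move: uvert; rewrite /= -/(map _ (d :: q1)) xh.
- move: uvert; rewrite chain_verts // lg -yg rcons_uniq => /andP[h1 h2].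
  by rewrite map_cons cons_uniq h1 h2.
Qed.

(** Without a cycle a trail could be extended forever, but one with [#|V|.+1] edges has more
    distinct vertices than [V]. *)
Lemma leafless_cycle C : loopless C -> leafless C -> C != set0 -> ~ forest C.
Proof.
move=> noloop ll /set0Pn[e eC] forC.
have trails k : exists2 ds, trail C ds & size ds = k.+1.
  elim: k => [|k [[|d q] // tr sz]].
    exists [:: (e, true)] => //; rewrite /= eC /= inE andbT.
    exact: noloop.
  have [[ds cyc]|[d' tr']] := trail_extend noloop ll tr.
    by have := forC ds; rewrite cyc.
  by exists [:: d', d & q] => //=; rewrite -sz.
have [[|d q] // /and4P[_ _ _ u] [sz]] := trails #|V|.
by have := max_card (mem (dart_src d :: map (@dart_tgt V) (d :: q)));
  rewrite (card_uniqP u) /= size_map sz; lia.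
Qed.

Lemma degE A v : deg A v = #|[set e in A | incident v e]|.
Proof.
rewrite /deg -sum1_card big_mkcond [RHS]big_mkcond /=; apply: eq_bigr => e _.
by rewrite !inE; case: (e \in A); case: (incident v e).
Qed.

(** A nonempty forest has a leaf by [leafless_cycle], and removing its edge uncovers the leaf
    vertex. *)
Lemma forest_card F : loopless F -> forest F ->
  #|F| <= #|[set v | [exists e in F, incident v e]]|.
Proof.
have [k] := ubnP #|F|; elim: k F => // k IH F ltF noloop forF.
case: (eqVneq F set0) => [->|F0]; first by rewrite cards0.
have : ~~ leafless F by apply/negP => ll; apply: leafless_cycle forF.
rewrite negb_forall => /existsP[v]; rewrite negb_forall_in => /exists_inP[e].
move=> /andP[eF ve]; rewrite negb_exists => /forallP ne.
have F'F : F :\ e \subset F by rewrite subD1set.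
have := IH (F :\ e); rewrite (cardsD1 e F) eF in ltF *.
move=> /(_ _ _ (forestS F'F forF)) IH'; rewrite add1n.
apply: leq_ltn_trans (IH' _ _) _; first by [].
  by move=> x /(subsetP F'F); apply: noloop.
apply: proper_card; rewrite properE; apply/andP; split.
  apply/subsetP => x; rewrite !inE => /exists_inP[e' /(subsetP F'F) h1 h2].
  by apply/exists_inP; exists e'.
apply/subsetPn; exists v; first by rewrite inE; apply/exists_inP; exists e.
rewrite inE; apply/exists_inP => -[e']; rewrite !inE => /andP[h1 h2] h3.
by have := ne e'; rewrite h2 h3 h1.
Qed.

Lemma degS A' A v : A' \subset A -> deg A v = deg A' v + deg (A :\: A') v.
Proof. by move=> sA; rewrite /deg (big_setID A') /= (setIidPr sA). Qed.

Lemma deg_gt0 A v e : e \in A -> incident v e -> 0 < deg A v.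
Proof. by move=> eA ve; rewrite degE card_gt0; apply/set0Pn; exists e; rewrite inE eA. Qed.

Lemma deg_gt1P A v e : e \in A -> incident v e ->
  (exists e', [/\ e' \in A, incident v e' & e' != e]) <-> 1 < deg A v.
Proof.
move=> eA ve; rewrite degE (cardsD1 e) !inE eA ve /= ltnS card_gt0; split.
  case=> e' [h1 h2 h3]; apply/set0Pn; exists e'; by rewrite !inE h1 h2 h3.
by case/set0Pn => e'; rewrite !inE => /and3P[]; exists e'.
Qed.

Lemma sum_deg A : loopless A -> \sum_v deg A v = 2 * #|A|.
Proof.
move=> noloop; rewrite exchange_big mulnC -sum_nat_const; apply: eq_bigr => e eA.
have ne := noloop e eA; rewrite (bigD1 e.1) // (bigD1 e.2) 1?eq_sym //=.
rewrite /incident !eqxx orbT big1 // => v /andP[h1 h2].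
by rewrite ![_ == v]eq_sym (negPf h1) (negPf h2).
Qed.

(** Truncated subtraction makes isolated vertices count 0. The degree term alone would not do: it
    stays the same when a component that is a bare cycle disappears, but then an edge of [S]
    goes. *)
Definition excess S A : nat := \sum_v (deg A v - 2) + #|S :&: A|.

(* If the excess stayed put, the edges lost would form a leafless subgraph
   avoiding S. *)
Lemma excess_lt S E A' A : loopless E -> forest (E :\: S) -> A \subset E ->
  A' \proper A -> core A -> core A' -> excess S A' < excess S A.
Proof.
move=> noloop forE sE /andP[sA nsA] coreA coreA'; rewrite ltnNge; apply/negP => le.
have le1 : \sum_v (deg A' v - 2) <= \sum_v (deg A v - 2).
  by apply: leq_sum => v _; rewrite leq_sub2r // (degS _ sA) leq_addr.
have le2 : #|S :&: A'| <= #|S :&: A| by rewrite subset_leq_card // setIS.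
(* Both terms of the excess are monotone, so totals that do not drop force equality at each vertex
   and on [S]. *)
have eqv v : deg A v - 2 <= deg A' v - 2.
  rewrite leqNgt; apply/negP => lt.
  have : \sum_v (deg A' v - 2) < \sum_v (deg A v - 2).
    rewrite (bigD1 v) // [ltnRHS](bigD1 v) //= -addSn leq_add //.
    by apply: leq_sum => u _; rewrite leq_sub2r // (degS _ sA) leq_addr.
  by move: le; rewrite /excess; lia.
have eqS : S :&: A' = S :&: A.
  apply/eqP; rewrite eqEcard setIS //=.
  by rewrite -(leq_add2l (\sum_v (deg A v - 2))) (leq_trans le) // leq_add2r.
apply: (@leafless_cycle (A :\: A')).
- by move=> e /setDP[/(subsetP sE) /noloop].
(* A vertex of degree at least 3 in [A] keeps its degree, so a lost edge ends at vertices of degree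
   2. Their degree in [A'] is below 2 and not 1, so both of their edges are lost. *)
- apply/leaflessP => v e eD ve; apply/deg_gt1P => //.
  have := deg_gt0 eD ve; have := degS v sA.
  by have := coreA v; have := coreA' v; have := eqv v; lia.
- by rewrite setD_eq0.
- apply: forestS forE; apply/subsetP => e /setDP[eA neA]; rewrite !inE (subsetP sE) //.
  rewrite andbT; apply: contra neA => eS.
  by have : e \in S :&: A; [rewrite inE eS | rewrite -eqS inE => /andP[]].
Qed.

(** Origin of the factor 3. With no vertex of degree 1, the degree term is [2 * #|A|] minus twice
    the number of covered vertices. By [forest_card] the edges outside [S] are at most as many as
    these vertices, so the term is at most [2 * #|A :&: S|]; the second term adds [#|S :&: A|]. *)
Lemma excess_core S E A : loopless E -> forest (E :\: S) -> A \subset E ->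
  core A -> excess S A <= 3 * #|S|.
Proof.
move=> noloop forE sE coreA.
have noloopA : loopless A by move=> e /(subsetP sE)/noloop.
have h1 : \sum_v (deg A v - 2) + 2 * #|[set v | 0 < deg A v]| = 2 * #|A|.
  rewrite -sum_deg // -sum1_card big_distrr /= [X in _ + X]big_mkcond -big_split /=.
  by apply: eq_bigr => v _; rewrite inE; have := coreA v; case: (deg A v) => [|[|k]] //= _; lia.
have h2 : #|A| = #|A :&: S| + #|A :\: S| by rewrite cardsID.
have h3 : #|A :\: S| <= #|[set v | 0 < deg A v]|.
  have sD : A :\: S \subset E :\: S by rewrite setSD.
  apply: leq_trans (forest_card _ (forestS sD forE)) _.
    by move=> e /setDP[/noloopA].
  apply: subset_leq_card; apply/subsetP => v; rewrite !inE => /exists_inP[e].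
  by move=> /setDP[eA _]; apply: deg_gt0.
have h4 : #|S :&: A| <= #|S| by rewrite subset_leq_card // subsetIl.
by rewrite setIC in h2; rewrite /excess; lia.
Qed.

End Incidence.

(** * Reachability in acyclic digraphs *)

Section Acyclic.
Variables (V : finType) (G : digraph V).
Hypothesis acG : acyclic G.
Implicit Types u v w x y : V.

Lemma arc_no_return x y : arc G x y -> ~~ connect (arc G) y x.
Proof.
move=> xy; apply/negP => /connectP[p yp xE].
by have := @acG (y :: p); rewrite /= rcons_path yp -xE xy => /(_ isT).
Qed.

Lemma connect_first v u : connect (arc G) v u ->
  v = u \/ exists2 w, arc G v w & connect (arc G) w u.
Proof.
case/connectP => [[|w p] /=] => [_ ->|/andP[vw wp] ->]; [by left | right].
by exists w => //; apply/connectP; exists p.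
Qed.

Lemma connect_last v u : connect (arc G) v u ->
  v = u \/ exists2 y, connect (arc G) v y & arc G y u.
Proof.
case/connectP => p; elim/last_ind: p => [_ ->|p y _]; first by left.
rewrite rcons_path last_rcons => /andP[vp py] ->; right.
by exists (last v p) => //; apply/connectP; exists p.
Qed.

(** The number of ancestors is the rank used for induction along arcs. *)
Definition ancestors u : {set V} := [set x | connect (arc G) x u].

Lemma ancestors_lt x y : arc G x y -> #|ancestors x| < #|ancestors y|.
Proof.
move=> xy; apply: proper_card; rewrite properE; apply/andP; split.
  by apply/subsetP => z; rewrite !inE => zx; apply: connect_trans zx (connect1 xy).
by apply/subsetPn; exists y; rewrite !inE ?connect0 ?arc_no_return.
Qed.

(* The arcs on the paths from v to the first vertex where two branches meet. *)
Lemma meeting_leafless v w1 w2 u :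
  arc G v w1 -> arc G v w2 -> w1 != w2 ->
  connect (arc G) w1 u -> connect (arc G) w2 u ->
  exists C : {set V * V}, [/\ C \subset edges G, leafless C, (v, w1) \in C
    & forall e, e \in C -> connect (arc G) v e.1].
Proof.
move=> vw1 vw2 ne.
(* Move the meeting point backwards until no in-neighbour of it is a meeting point. *)
have [k] := ubnP #|ancestors u|; elim: k u => // k IH u ltu w1u w2u.
have [[y /andP[w1y w2y] yu]|noy] :
    (exists2 y, connect (arc G) w1 y && connect (arc G) w2 y & arc G y u) \/
    (forall y, connect (arc G) w1 y -> connect (arc G) w2 y -> ~~ arc G y u).
- case: (boolP [exists y, [&& connect (arc G) w1 y, connect (arc G) w2 y & arc G y u]]).
    by case/existsP => y /and3P[h1 h2 h3]; left; exists y => //; rewrite h1.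
  rewrite negb_exists => /forallP H; right => y h1 h2; have := H y.
  by rewrite h1 h2.
- by apply: (IH y) => //; have := ancestors_lt yu; lia.
pose C := [set e in edges G | connect (arc G) v e.1 & connect (arc G) e.2 u].
have inC x y : ((x, y) \in C) = [&& arc G x y, connect (arc G) v x & connect (arc G) y u].
  by rewrite !inE.
exists C; split.
- by apply/subsetP => e; rewrite inE => /andP[].
- apply/leaflessP => x [y z]; rewrite inC /incident /= => /and3P[yz vy zu] xyz.
  have out t : arc G x t -> connect (arc G) v x -> connect (arc G) t u -> (x, t) \in C.
    by rewrite inC => -> -> ->.
  have vx : connect (arc G) v x.
    by case/orP: xyz => /eqP<- //; apply: connect_trans vy (connect1 yz).
  have xu : connect (arc G) x u.
    by case/orP: xyz => /eqP<- //; apply: connect_trans (connect1 yz) zu.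
  (* At [v] the arcs to [w1] and [w2] are two arcs of [C]. *)
  case: (eqVneq x v) => [xv|xnv].
    have zv : z != v.
      apply/eqP => zv; have := arc_no_return yz.
      by rewrite zv vy.
    have yx : y = v by move: xyz; rewrite xv (negPf zv) orbF => /eqP.
    case: (eqVneq z w1) => zw.
      exists (v, w2); split; rewrite ?inC ?vw2 ?connect0 ?w2u //= ?xv ?eqxx //.
      by rewrite xpair_eqE zw [w2 == _]eq_sym (negPf ne) andbF.
    exists (v, w1); split; rewrite ?inC ?vw1 ?connect0 ?w1u //= ?xv ?eqxx //.
    by rewrite xpair_eqE [w1 == _]eq_sym (negPf zw) andbF.
  have [p vp px] : exists2 p, connect (arc G) v p & arc G p x.
    by case: (connect_last vx) => // E; rewrite E eqxx in xnv.
  have pC : (p, x) \in C by rewrite inC px vp xu.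
  (* At [u] the last arcs of the two branches have different tails, as a common tail would be an
     earlier meeting point. A branch can also be the single arc from [v] to [u], a case that [br]
     separates. *)
  case: (eqVneq x u) => [E|xnu].
    have [p' [vp' p'x np]] : exists p', [/\ connect (arc G) v p', arc G p' x & p' != p].
      have br w : arc G v w -> connect (arc G) w u ->
          arc G v u /\ w = u \/ exists2 q, connect (arc G) w q & arc G q u.
        by move=> vw; case/connect_last => [wu|]; [left; rewrite -wu | right].
      have sep q1 q2 : arc G v w2 -> connect (arc G) w1 q1 -> arc G q1 u ->
          connect (arc G) w2 q2 -> q1 != q2.
        move=> _ h1 h2 h3; apply: contraTneq h2 => E2; apply: noy => //.
        by rewrite E2.
      have vne w q : arc G v w -> connect (arc G) w q -> q != v.
        by move=> vw wq; apply: contraTneq wq => ->; apply: arc_no_return.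
      have two a b : connect (arc G) v a -> arc G a u -> connect (arc G) v b -> arc G b u ->
          a != b -> exists p', [/\ connect (arc G) v p', arc G p' x & p' != p].
        rewrite E => va au vb bu ab; case: (eqVneq a p) => [ap|]; last by exists a.
        by exists b; split=> //; rewrite -ap eq_sym.
      have vq w q : arc G v w -> connect (arc G) w q -> connect (arc G) v q.
        by move=> /connect1; apply: connect_trans.
      case: (br _ vw1 w1u) => [[vu w1E]|[q1 h1 h2]];
        case: (br _ vw2 w2u) => [[vu' w2E]|[q2 h3 h4]].
      - by rewrite w1E w2E eqxx in ne.
      - by apply: (two q2 v); rewrite ?connect0 ?(vq w2) // (vne w2).
      - by apply: (two q1 v); rewrite ?connect0 ?(vq w1) // (vne w1).
      - by apply: (two q1 q2); rewrite ?(vq w1 q1) ?(vq w2 q2) // sep.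
    case: (eqVneq y p) => yp.
      exists (p', x); split; rewrite ?inC ?vp' ?p'x ?xu //= ?eqxx ?orbT //.
      by rewrite xpair_eqE yp (negPf np).
    exists (p, x); split; rewrite //= ?eqxx ?orbT //.
    by rewrite xpair_eqE eq_sym (negPf yp).
  (* Any other vertex has an arc of [C] coming in and one going out, at least one of which differs
     from the given arc. *)
  have [s xs su] : exists2 s, arc G x s & connect (arc G) s u.
    by case: (connect_first xu) => // E; rewrite E eqxx in xnu.
  have sC : (x, s) \in C by rewrite inC xs vx su.
  case/orP: xyz => /eqP E.
    exists (p, x); split; rewrite //= ?eqxx ?orbT //.
    rewrite xpair_eqE; apply/nandP; left; apply/eqP => py.
    by move: px; rewrite py E (arc_irrefl G x).
  exists (x, s); split; rewrite //= ?eqxx //.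
  rewrite xpair_eqE; apply/nandP; left; apply/eqP => xy.
  by move: yz; rewrite E xy (arc_irrefl G y).
- by rewrite inC vw1 connect0 w1u.
- by move=> e; rewrite inE => /and3P[].
Qed.

(** By acyclicity no out-neighbour of [v] reaches [v], and by disjointness at most one reaches any
    other [u]. Stating this for indicators makes the formula for weighted sums a mere exchange of
    summations. *)
Lemma connect_count v u :
  (forall w1 w2, arc G v w1 -> arc G v w2 -> w1 != w2 ->
     connect (arc G) w1 u -> ~~ connect (arc G) w2 u) ->
  connect (arc G) v u = (v == u) + \sum_(w | arc G v w) connect (arc G) w u :> nat.
Proof.
move=> disj; case: (eqVneq v u) => [->|vu].
  rewrite connect0 big1 // => w uw.
  by rewrite (negPf (arc_no_return uw)).
case: (boolP (connect (arc G) v u)) => [vcu|nvu].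
  case: (connect_first vcu) => [E|[w vw wu]]; first by rewrite E eqxx in vu.
  rewrite (bigD1 w) //= wu big1 // => w' /andP[vw' ne].
  by apply/eqP; rewrite eqb0 (disj w) // eq_sym.
rewrite big1 // => w vw; apply/eqP; rewrite eqb0; apply: contra nvu.
exact: connect_trans (connect1 vw).
Qed.

Variables (R : zmodType) (a : V -> R).
Local Open Scope ring_scope.
Import GRing.Theory.

Definition reach_sum v : R := \sum_(u in reach G v) a u.

Lemma reach_sum_disjoint v :
  (forall w1 w2 u, arc G v w1 -> arc G v w2 -> w1 != w2 ->
     connect (arc G) w1 u -> ~~ connect (arc G) w2 u) ->
  reach_sum v = a v + \sum_(w | arc G v w) reach_sum w.
Proof.
move=> disj.
have rE w : reach_sum w = \sum_u a u *+ connect (arc G) w u.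
  rewrite /reach_sum big_mkcond /=; apply: eq_bigr => u _.
  by rewrite inE mulrb.
rewrite rE (eq_bigr _ (fun w _ => rE w)) exchange_big /=.
have -> : a v = \sum_u a u *+ (v == u).
  rewrite (bigD1 v) //= eqxx big1 ?addr0 // => u uv.
  by rewrite eq_sym (negPf uv).
rewrite -big_split /=; apply: eq_bigr => u _.
rewrite connect_count => [|w1 w2 *]; last exact: (disj w1).
by rewrite mulrnDr -sumrMnr.
Qed.

End Acyclic.

(** * Topological sorting *)

Section Kahn.
Variables (V : finType) (es : seq (V * V)).
Hypothesis uniq_es : uniq es.
Hypothesis noloop : forall e, e \in es -> e.1 != e.2.
Implicit Types (q : seq V) (L : seq (V * V)).

Definition pending L (v : V) : nat :=
  count (fun e => (e.2 == v) && (e \notin L)) es.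

(** [q] contains every vertex ever queued, including those already processed, so positions in [q]
    are a topological numbering; [L] is the list of emitted edges. A head not yet queued has [index]
    equal to [size q], so the order clause covers it too. *)
Definition kahn_inv q L : Prop :=
  [/\ uniq q, uniq L /\ {subset L <= es},
      forall v, (v \in q) = (pending L v == 0),
      forall e, e \in L -> e.1 \in q /\ index e.1 q < index e.2 q
    & pairwise leq [seq index e.1 q | e <- L]].

Lemma pending_rcons L x v : x \in es -> x \notin L ->
  pending L v = (x.2 == v) + pending (rcons L x) v.
Proof.
move=> xes xL; rewrite /pending.
have p := perm_to_rem xes; rewrite !(permP p) /= xL andbT mem_rcons inE eqxx /=.
rewrite andbF add0n; congr (_ + _); apply: eq_in_count => e.
rewrite mem_rem_uniq // inE => /andP[ne _].
by rewrite mem_rcons inE negb_or ne.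
Qed.

(** The edge [x] is itself pending at its head, so the head is not queued before [x] is emitted and
    can only be appended behind the tail. *)
Lemma kahn_emit q L x : kahn_inv q L -> x \in es -> x \notin L -> x.1 \in q ->
  (forall e, e \in L -> index e.1 q <= index x.1 q) ->
  x.2 \notin q /\
  kahn_inv (if pending (rcons L x) x.2 == 0 then rcons q x.2 else q) (rcons L x).
Proof.
move=> [uq [uL sL] qP Lq sq] xes xL x1q le.
have x2q : x.2 \notin q.
  by rewrite qP (pending_rcons _ xes xL) eqxx.
split=> //; set q' := if _ then _ else _.
have q'P v : (v \in q') = (v \in q) || (v == x.2) && (pending (rcons L x) x.2 == 0).
  rewrite /q'; case: ifP => _; last by rewrite andbF orbF.
  by rewrite mem_rcons inE andbT orbC.
have idx v : v \in q -> index v q' = index v q.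
  by rewrite /q'; case: ifP => // _ vq; rewrite -cats1 index_cat vq.
have idx_le v : index v q <= index v q'.
  rewrite /q'; case: ifP => // _; rewrite -cats1 index_cat.
  by case: ifP => // vq; rewrite memNindex ?vq // leq_addr.
have memL e : e \in rcons L x -> e.1 \in q.
  by rewrite mem_rcons inE => /predU1P[->|/Lq[]].
split.
- by rewrite /q'; case: ifP => // _; rewrite rcons_uniq x2q.
- split; first by rewrite rcons_uniq xL.
  by move=> e; rewrite mem_rcons inE => /predU1P[->|/sL].
- move=> v; rewrite q'P qP (pending_rcons v xes xL) [x.2 == v]eq_sym.
  by case: (eqVneq v x.2) => [->|ne] //=; rewrite ?orbF.
- move=> e eL; have e1q := memL _ eL; rewrite q'P e1q idx //; split=> //.
  apply: leq_trans (idx_le _); move: eL; rewrite mem_rcons inE => /predU1P[->|/Lq[]//].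
  by rewrite (memNindex x2q) index_mem.
- have -> : [seq index e.1 q' | e <- rcons L x] = [seq index e.1 q | e <- rcons L x].
    by apply/eq_in_map => e /memL; apply: idx.
  rewrite map_rcons pairwise_rcons sq andbT.
  by apply/allP => _ /mapP[e eL ->]; apply: le.
Qed.

(** Every vertex gets queued, by induction on the number of ancestors: the tails of its in-edges are
    queued, so these edges are emitted and none is pending. *)
Lemma kahn_complete (G : digraph V) q L : acyclic G ->
  (forall x y, ((x, y) \in es) = arc G x y) -> kahn_inv q L ->
  (forall e, e \in es -> (e \in L) = (e.1 \in q)) -> perm_eq L es.
Proof.
move=> acG esG [uq [uL sL] qP _ _] Lq.
have qall v : v \in q.
  have [k] := ubnP #|ancestors G v|; elim: k v => // k IH v ltv.
  rewrite qP eqn0Ngt -has_count; apply/hasPn => -[x y] xes /=.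
  apply/negP => /andP[/eqP yv]; rewrite Lq // IH //=.
  by have := ancestors_lt acG (x := x) (y := v); rewrite -yv -esG xes => /(_ isT); rewrite yv; lia.
apply: uniq_perm => // e; apply/idP/idP => [/sL//|ees].
by rewrite Lq.
Qed.

End Kahn.

(** * Peeling and cutting *)

Section Cutting.
Variable V : finType.
Implicit Types (A C : {set V * V}) (X : {set V}).

(** The last clause lets the program recognise a surviving edge by the positive degrees of both its
    ends, without a record of the deleted edges. *)
Definition peeled A A' : Prop :=
  [/\ A' \subset A, forall C, leafless C -> C \subset A -> C \subset A' &
      forall e, e \in A -> [\/ e \in A', deg A' e.1 = 0 | deg A' e.2 = 0]].

Lemma peeled_refl A : peeled A A.
Proof. by split=> // e eA; constructor 1. Qed.

Lemma deg0S A A' v : A' \subset A -> deg A v = 0 -> deg A' v = 0.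
Proof. by move=> sA; rewrite (degS _ sA); lia. Qed.

Lemma peeled_trans A A' A'' : peeled A A' -> peeled A' A'' -> peeled A A''.
Proof.
move=> [s1 c1 e1] [s2 c2 e2]; split; first exact: subset_trans s2 s1.
  by move=> C ll sC; apply: c2 => //; apply: c1.
move=> e eA; case: (e1 e eA) => [/e2//|d|d].
  by constructor 2; apply: deg0S d.
by constructor 3; apply: deg0S d.
Qed.

Lemma peeled_leaf A e x : e \in A -> incident x e -> deg (A :\ e) x = 0 ->
  peeled A (A :\ e).
Proof.
move=> eA xe d0; split; first exact: subD1set.
  move=> C ll sC; apply/subsetP => e' e'C; rewrite !inE (subsetP sC) // andbT.
  apply: contraTneq e'C => ->; apply/negP => eC.
  have [e'' [h1 h2 h3]] := (leaflessP _ ll) x e eC xe.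
  have h4 : e'' \in A :\ e by rewrite !inE h3 (subsetP sC).
  by have := deg_gt0 h4 h2; rewrite d0.
move=> e' e'A; case: (eqVneq e' e) => [->|ne]; last by constructor 1; rewrite !inE ne.
by case/orP: xe => /eqP->; [constructor 2 | constructor 3].
Qed.

Variables (E S : {set V * V}) (L : seq (V * V)).
Hypotheses (noloop : loopless E) (forE : forest (E :\: S)).
Hypothesis LE : forall e, (e \in L) = (e \in E).

Definition first_in X C e : Prop :=
  [/\ e \in C, e.1 \in X & forall e', e' \in C -> index e L <= index e' L].

(** [A] is the set of surviving edges and [X] the set of suspects after [j] edges of [L]. A leafless
    subgraph is either intact or has had its first edge in [L] cut and the tail of that edge marked.
    The last clause charges suspects to the loss of excess. *)
Definition cut_inv (j : nat) A X : Prop :=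
  [/\ A \subset E /\ core A,
  (forall e, e \in E -> e \in take j L \/ [\/ e \in A, deg A e.1 = 0 | deg A e.2 = 0]),
  (forall e, e \in A -> e \notin take j L),
  (forall C, leafless C -> C \subset E -> C \subset A \/
     exists2 e, e \in take j L & first_in X C e) &
  #|X| + excess S A <= 3 * #|S|].

Lemma cut_inv0 A : peeled E A -> core A -> cut_inv 0 A set0.
Proof.
move=> [sA ll del] coreA; split=> //.
- by move=> e /del; right.
- by move=> e _; rewrite take0.
- by move=> C llC sC; left; apply: ll.
- by rewrite cards0 add0n; apply: excess_core sA coreA.
Qed.

Lemma cut_inv_skip j A X e : take j.+1 L = rcons (take j L) e -> e \notin A ->
  cut_inv j A X -> cut_inv j.+1 A X.
Proof.
move=> tk eA [sA del inA Hll cX].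
have tkS e' : e' \in take j.+1 L = (e' == e) || (e' \in take j L).
  by rewrite tk mem_rcons inE.
split=> // [e'|e'|C ll sC]; rewrite ?tkS.
- by move=> /del[->|]; [left; rewrite orbT | right].
- move=> e'A; rewrite negb_or inA // andbT.
  by apply: contraNneq eA => <-.
- case: (Hll C ll sC) => [|[e' h1 h2]]; [by left | right].
  by exists e'; rewrite // tkS h1 orbT.
Qed.

(** An intact leafless subgraph avoiding [e] survives the peeling. One that contains [e] lies in
    [A], which has none of the first [j] edges, so [e] is its first edge. The new suspect is paid
    for by [excess_lt]. *)
Lemma cut_inv_cut j A A' X e : take j.+1 L = rcons (take j L) e -> e \in A ->
  index e L = j -> peeled (A :\ e) A' -> core A' ->
  cut_inv j A X -> cut_inv j.+1 A' (e.1 |: X).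
Proof.
move=> tk eA ej [sA' ll' del'] coreA' [[sA coreA] del inA Hll cX].
have tkS e' : e' \in take j.+1 L = (e' == e) || (e' \in take j L).
  by rewrite tk mem_rcons inE.
have sAA : A' \subset A := subset_trans sA' (subD1set A e).
split=> [|e' e'E|e' e'A|C ll sC|].
- by split=> //; apply: subset_trans sAA sA.
- rewrite tkS; case: (eqVneq e' e) => [->|ne] /=; first by left.
  case: (del e' e'E) => [|[e'A|d|d]]; first by left.
  + by right; apply: del'; rewrite !inE ne.
  + by right; constructor 2; apply: deg0S d.
  + by right; constructor 3; apply: deg0S d.
- rewrite tkS negb_or inA ?(subsetP sAA) // andbT.
  by have /(subsetP sA') := e'A; rewrite !inE => /andP[].
- case: (Hll C ll sC) => [sCA|[e' h1 [h2 h3 h4]]]; last first.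
    by right; exists e'; rewrite ?tkS ?h1 ?orbT //; split=> //; rewrite !inE h3 orbT.
  case: (boolP (e \in C)) => eC; last first.
    by left; apply: ll' => //; rewrite subsetD1 sCA.
  right; exists e; first by rewrite tkS eqxx.
  split=> //; first by rewrite !inE eqxx.
  move=> e' e'C; have e'A := subsetP sCA _ e'C; rewrite ej leqNgt.
  have := inA e' e'A; rewrite in_take // LE.
  exact: subsetP sA _ e'A.
- have pA : A' \proper A.
    rewrite properE sAA; apply/subsetPn; exists e => //.
    by apply: contraTN eA => /(subsetP sA'); rewrite !inE eqxx.
  have lt := excess_lt noloop forE sA pA coreA coreA'.
  apply: leq_trans cX; rewrite cardsU1; apply: leq_trans (leq_add (leqnn #|X|) lt).
  by case: (_ \notin _); rewrite ?add1n ?add0n addnS ?addSn.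
Qed.

(** Once all of [L] is processed [A] is empty, so no nonempty leafless subgraph is intact. *)
Lemma cut_inv_end A X : cut_inv (size L) A X -> #|X| <= 3 * #|S| /\
  forall C, leafless C -> C \subset E -> C != set0 -> exists e, first_in X C e.
Proof.
move=> [[sA _] _ inA Hll cX]; split; first by apply: leq_trans cX; apply: leq_addr.
move=> C ll sC /set0Pn[e eC]; case: (Hll C ll sC) => [sCA|[e' _]]; last by exists e'.
have eA := subsetP sCA _ eC; have := inA e eA.
by rewrite take_size LE (subsetP sA).
Qed.

End Cutting.

(** * Edges in topological order *)

Section Topological.
Variables (V : finType) (G : digraph V) (L : seq (V * V)) (pos : V -> nat).
Implicit Types (u v x y : V) (e : V * V).

Definition topological : Prop :=
  [/\ uniq L, forall x y, ((x, y) \in L) = arc G x y,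
      forall x y, arc G x y -> pos x < pos y &
      forall e e', e \in L -> e' \in L -> index e L <= index e' L -> pos e.1 <= pos e'.1].

Hypothesis topoL : topological.

Lemma in_topological e : (e \in L) = arc G e.1 e.2.
Proof. by have [_ <- _ _] := topoL; case: e. Qed.

Lemma connect_pos x y : connect (arc G) x y -> pos x <= pos y.
Proof.
have [_ _ posG _] := topoL; case/connectP => p; elim: p x => [x _ ->|z p IH x] //=.
by case/andP => /posG xz zp yE; apply: leq_trans (ltnW xz) (IH _ zp yE).
Qed.

Lemma connect_pos_lt x y : connect (arc G) x y -> x != y -> pos x < pos y.
Proof.
have [_ _ posG _] := topoL.
case/connectP => [[|z p]] /= => [_ ->|/andP[/posG xz zp] yE _]; first by rewrite eqxx.
by apply: leq_trans xz _; apply: connect_pos; apply/connectP; exists p.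
Qed.

Lemma in_out_lt e e' : e \in L -> e' \in L -> e.2 = e'.1 -> index e L < index e' L.
Proof.
have [_ _ posG idx] := topoL; move=> eL e'L E; rewrite ltnNge; apply/negP => /idx.
move=> /(_ e'L eL); rewrite leqNgt -E posG //.
by rewrite -in_topological.
Qed.

(** The marks of a search from [v] after [j] edges, written with true reachability of the tails
    instead of their marks; [marked_tail] shows that the two tests agree when an edge is scanned. *)
Definition marked v j u : bool :=
  (u == v) || has (fun e => connect (arc G) v e.1 && (e.2 == u)) (take j L).

Lemma marked0 v u : marked v 0 u = (u == v).
Proof. by rewrite /marked take0 orbF. Qed.

Lemma markedS v j e u : take j.+1 L = rcons (take j L) e ->
  marked v j.+1 u = marked v j u || connect (arc G) v e.1 && (e.2 == u).
Proof. by move=> tk; rewrite /marked tk -cats1 has_cat /= orbF orbA. Qed.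

Lemma marked_connect v j u : marked v j u -> connect (arc G) v u.
Proof.
case/orP => [/eqP->|/hasP[e /mem_take eL /andP[ve /eqP<-]]]; first exact: connect0.
by apply: connect_trans ve (connect1 _); rewrite -in_topological.
Qed.

(** All edges into the tail of [e] come before [e] in [L], so its mark is final when [e] is scanned.
    Hence one pass is a complete search. *)
Lemma marked_tail v e : e \in L -> marked v (index e L) e.1 = connect (arc G) v e.1.
Proof.
move=> eL; apply/idP/idP => [|vt]; first exact: marked_connect.
case: (connect_last vt) => [->|[y vy yt]]; first by rewrite /marked eqxx.
apply/orP; right; apply/hasP; exists (y, e.1); last by rewrite /= vy eqxx.
have yL : (y, e.1) \in L by rewrite in_topological.
by rewrite in_take // in_out_lt.
Qed.

Lemma marked_all v u : marked v (size L) u = connect (arc G) v u.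
Proof.
apply/idP/idP => [|vu]; first exact: marked_connect.
case: (connect_last vu) => [->|[y vy yu]]; first by rewrite /marked eqxx.
apply/orP; right; apply/hasP; exists (y, u); last by rewrite /= vy eqxx.
by rewrite take_size in_topological.
Qed.

(** The first edge of the leafless subgraph has a tail in [X] reachable from [v]; being no later
    than [(v, w1)], its tail has position at most that of [v] and so equals [v]. *)
Lemma susp_disjoint (X : {set V}) v w1 w2 u :
  acyclic G ->
  (forall C : {set V * V}, leafless C -> C \subset edges G -> C != set0 ->
     exists e, first_in L X C e) ->
  v \notin X -> arc G v w1 -> arc G v w2 -> w1 != w2 ->
  connect (arc G) w1 u -> ~~ connect (arc G) w2 u.
Proof.
move=> acG Hll vX vw1 vw2 ne w1u; apply/negP => w2u.
have [C [sC llC vC vC1]] := meeting_leafless acG vw1 vw2 ne w1u w2u.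
have [|e [eC eX first_e]] := Hll C llC sC; first by apply/set0Pn; exists (v, w1).
have inL e' : e' \in C -> e' \in L.
  by move=> /(subsetP sC); rewrite inE in_topological.
have [_ _ _ idx] := topoL.
have le := idx _ _ (inL _ eC) (inL _ vC) (first_e _ vC).
case: (eqVneq v e.1) => [E|vne]; first by rewrite E eX in vX.
by have := connect_pos_lt (vC1 e eC) vne; rewrite ltnNge le.
Qed.

Lemma out_sum (R : zmodType) (F : V -> R) v j :
  (forall e, e \in take j L -> e.1 != v) ->
  (\sum_(e <- drop j L | e.1 == v) F e.2 = \sum_(w | arc G v w) F w)%R.
Proof.
move=> noj; have [uL _ _ _] := topoL.
have -> : (\sum_(e <- drop j L | e.1 == v) F e.2 = \sum_(e <- L | e.1 == v) F e.2)%R.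
  rewrite -[in RHS](cat_take_drop j L) big_cat /=.
  rewrite [X in (X + _)%R](_ : _ = 0%R) ?GRing.add0r //.
  by rewrite big_seq_cond big1 // => e /andP[/noj/negP].
rewrite -big_filter.
have p : perm_eq [seq e <- L | e.1 == v] [seq (v, w) | w <- enum (arc G v)].
  apply: uniq_perm; first exact: filter_uniq.
    by rewrite map_inj_uniq ?enum_uniq // => x y [].
  move=> [x y]; rewrite mem_filter in_topological /=; apply/andP/mapP.
    by case=> /eqP-> vy; exists y; rewrite // mem_enum.
  by case=> z; rewrite mem_enum => vz [-> ->].
by rewrite (perm_big _ p) big_map big_enum.
Qed.

End Topological.

(** * The program *)

(* The input occupies the first 2m + 2 integer cells; field k of item i is
   stored above it, at 2m + 2 + stride * i + k.  Scalar variables are fields of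
   item 0.  The constructors HT e and HH e read the tail and the head of the
   input edge number e. *)
Definition stride := 32.
(** An upper bound on the time of each basic command and each test, address computations
    included. *)
Definition unit_cost := 128.

Inductive hexpr :=
  | HC of nat
  | HN
  | HM
  | HF of nat & hexpr
  | HT of hexpr
  | HH of hexpr
  | HB of binop & hexpr & hexpr.

Definition addr (k : nat) (e : expr) : expr :=
  Bin Add (Bin Add (Cst k.+2) (Bin Mul (Cst 2) (Read (Cst 1))))
          (Bin Mul (Cst stride) e).

Fixpoint comp (e : hexpr) : expr :=
  match e with
  | HC c => Cst c
  | HN => Read (Cst 0)
  | HM => Read (Cst 1)
  | HF k e => Read (addr k (comp e))
  | HT e => Read (Bin Add (Cst 2) (Bin Mul (Cst 2) (comp e)))
  | HH e => Read (Bin Add (Cst 3) (Bin Mul (Cst 2) (comp e)))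
  | HB o e1 e2 => Bin o (comp e1) (comp e2)
  end.

Definition hset (k : nat) (e1 e2 : hexpr) : cmd :=
  Store (addr k (comp e1)) (comp e2).

(** Fields are compared by [eqn], which computes on literal field numbers. *)
Definition upd (M : nat -> nat -> nat) (k i x : nat) : nat -> nat -> nat :=
  fun k' i' => if eqn k' k then (if i' == i then x else M k' i') else M k' i'.

Definition var (k : nat) : hexpr := HF k (HC 0).

Definition setv (k : nat) (e : hexpr) : cmd := hset k (HC 0) e.

Definition for_loop (k : nat) (bound : hexpr) (body : cmd) : cmd :=
  Seq (setv k (HC 0))
    (While (comp (HB Lt (var k) bound))
       (Seq body (setv k (HB Add (var k) (HC 1))))).

(** Field numbers. [vI] and [vJ] are counters, [vC] is the length of the queue, [vE] points into a
    list of outgoing edges, [vV] is the vertex whose edges are being emitted, and [vX] and [vY] are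
    working vertices. *)
Local Notation vI := 0 (only parsing).
Local Notation vJ := 1 (only parsing).
Local Notation vE := 2 (only parsing).
Local Notation vC := 3 (only parsing).
Local Notation vX := 4 (only parsing).
Local Notation vY := 5 (only parsing).
Local Notation vV := 6 (only parsing).
Local Notation INDEG := 8 (only parsing).
Local Notation FIRST := 9 (only parsing).
Local Notation NEXT := 10 (only parsing).
Local Notation QUEUE := 11 (only parsing).
Local Notation TAIL := 12 (only parsing).
Local Notation HEAD := 13 (only parsing).
Local Notation DEG := 14 (only parsing).
Local Notation SUM := 15 (only parsing).
Local Notation SUSP := 16 (only parsing).
Local Notation MARK := 17 (only parsing).

(** * The phases of the program *)

Definition incr (k : nat) (e : hexpr) : cmd :=
  hset k e (HB Add (HF k e) (HC 1)).

Definition decr (k : nat) (e : hexpr) : cmd :=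
  hset k e (HB Defs.Sub (HF k e) (HC 1)).

(* FIRST and NEXT hold the lists of outgoing edges, as edge numbers plus one
   with 0 for the end.  SUM is the sum of the neighbours in the underlying
   undirected graph: at a vertex of degree 1 it is the neighbour itself, so
   peeling needs no adjacency lists. *)
Definition scan_edges : cmd :=
  let t := HT (var vI) in
  let h := HH (var vI) in
  for_loop vI HM
    (Seq (hset NEXT (var vI) (HF FIRST t))
    (Seq (hset FIRST t (HB Add (var vI) (HC 1)))
    (Seq (incr INDEG h)
    (Seq (incr DEG t)
    (Seq (incr DEG h)
    (Seq (hset SUM t (HB Add (HF SUM t) h))
         (hset SUM h (HB Add (HF SUM h) t)))))))).



Definition push (e : hexpr) : cmd :=
  Seq (hset QUEUE (var vC) e) (incr vC (HC 0)).

Definition enqueue_sources : cmd :=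
  Seq (setv vC (HC 0))
    (for_loop vI HN
       (If (comp (HB Defs.Eq (HF INDEG (var vI)) (HC 0))) (push (var vI)) Skip)).

Definition emit : cmd :=
  Seq (decr vE (HC 0))
  (Seq (setv vX (HH (var vE)))
  (Seq (hset TAIL (var vJ) (var vV))
  (Seq (hset HEAD (var vJ) (var vX))
  (Seq (incr vJ (HC 0))
  (Seq (decr INDEG (var vX))
  (Seq (If (comp (HB Defs.Eq (HF INDEG (var vX)) (HC 0))) (push (var vX)) Skip)
       (setv vE (HF NEXT (var vE))))))))).

Definition sort_edges : cmd :=
  Seq (setv vJ (HC 0))
  (Seq (setv vI (HC 0))
    (While (comp (HB Lt (var vI) (var vC)))
      (Seq (setv vV (HF QUEUE (var vI)))
      (Seq (setv vE (HF FIRST (var vV)))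
      (Seq (While (comp (var vE)) emit)
           (incr vI (HC 0))))))).

Definition subv (k : nat) (e1 e2 : hexpr) : cmd :=
  hset k e1 (HB Defs.Sub (HF k e1) e2).

(** Removing the edge at a leaf lowers only one other degree, that of the neighbour, so the loop
    only needs to move on to the neighbour to catch every new leaf. *)
Definition peel : cmd :=
  While (comp (HB Defs.Eq (HF DEG (var vX)) (HC 1)))
    (Seq (setv vY (HF SUM (var vX)))
    (Seq (hset DEG (var vX) (HC 0))
    (Seq (hset SUM (var vX) (HC 0))
    (Seq (decr DEG (var vY))
    (Seq (subv SUM (var vY) (var vX))
         (setv vX (var vY))))))).

Definition peel_leaves : cmd :=
  for_loop vI HN (Seq (setv vX (var vI)) peel).

Definition cut_edge : cmd :=
  let t := HF TAIL (var vJ) in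
  let h := HF HEAD (var vJ) in
  Seq (hset SUSP t (HC 1))
  (Seq (decr DEG t)
  (Seq (decr DEG h)
  (Seq (subv SUM t h)
  (Seq (subv SUM h t)
  (Seq (setv vX t)
  (Seq peel
  (Seq (setv vX h) peel))))))).

Definition cut_edges : cmd :=
  for_loop vJ HM
    (If (comp (HF DEG (HF TAIL (var vJ))))
       (If (comp (HF DEG (HF HEAD (var vJ)))) cut_edge Skip) Skip).

(* The marks of the search from vertex i are the cells equal to i + 1, so no
   clearing is needed between searches. *)
Definition mark_loop : cmd :=
  for_loop vJ HM
    (If (comp (HB Defs.Eq (HF MARK (HF TAIL (var vJ))) (HB Add (var vI) (HC 1))))
       (hset MARK (HF HEAD (var vJ)) (HB Add (var vI) (HC 1))) Skip).

(** The sum goes to weight cell [n + i], since later searches still need the weights in the first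
    [n] cells. *)
Definition sum_loop : cmd :=
  let total := comp (HB Add HN (var vI)) in
  for_loop vJ HN
    (If (comp (HB Defs.Eq (HF MARK (var vJ)) (HB Add (var vI) (HC 1))))
       (WStore total (WAdd (WRead total) (WRead (comp (var vJ))))) Skip).

Definition search_suspects : cmd :=
  for_loop vI HN
    (If (comp (HF SUSP (var vI)))
       (Seq (hset MARK (var vI) (HB Add (var vI) (HC 1))) (Seq mark_loop sum_loop))
       Skip).

Definition copy_sums : cmd :=
  for_loop vI HN
    (If (comp (HF SUSP (var vI)))
       (WStore (comp (var vI)) (WRead (comp (HB Add HN (var vI))))) Skip).

Definition sweep_back : cmd :=
  let t := HF TAIL (var vJ) in
  let h := HF HEAD (var vJ) in
  Seq (setv vJ HM)
    (While (comp (var vJ))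
      (Seq (decr vJ (HC 0))
        (If (comp (HF SUSP t)) Skip
           (WStore (comp t) (WAdd (WRead (comp t)) (WRead (comp h))))))).

Definition reachability_program : cmd :=
  Seq scan_edges (Seq enqueue_sources (Seq sort_edges (Seq peel_leaves
    (Seq cut_edges (Seq search_suspects (Seq copy_sums sweep_back)))))).

(** * Budgeted execution *)

Section Logic.
Variables (R : zmodType) (n : nat) (es : seq ('I_n * 'I_n)) (W N : nat).
Local Notation m := (size es).
Local Notation S := (2 * m + 2 + stride * N).
Hypothesis defN : N = n + m + 2.
Hypothesis leW : 64 * (N * N) <= W.

(** * Machine states as arrays of fields, and evaluation without fault *)

Definition tl (i : nat) : nat := nth 0 [seq val x.1 | x <- es] i.
Definition hd (i : nat) : nat := nth 0 [seq val x.2 | x <- es] i.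

Implicit Types (M : nat -> nat -> nat) (w : nat -> R) (s : state R).

Definition rep M w s : Prop :=
  [/\ imem s 0 = n /\ imem s 1 = m,
      forall i, i < m -> imem s (2 * i).+2 = tl i /\ imem s (2 * i).+3 = hd i,
      forall k i, k < stride -> imem s (2 * m + 2 + stride * i + k) = M k i
    & forall i, wmem s i = w i].

Fixpoint den M (e : hexpr) : nat :=
  match e with
  | HC c => c
  | HN => n
  | HM => m
  | HF k e => M k (den M e)
  | HT e => tl (den M e)
  | HH e => hd (den M e)
  | HB o e1 e2 => binop_eval o (den M e1) (den M e2)
  end.

Fixpoint ok M (e : hexpr) : Prop :=
  match e with
  | HC c => c <= 64
  | HN | HM => True
  | HF k e => k < stride /\ (ok M e /\ den M e < N)
  | HT e | HH e => ok M e /\ den M e < m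
  | HB o e1 e2 => (ok M e1 /\ ok M e2)
      /\ binop_eval o (den M e1) (den M e2) < W
  end.

Lemma size_bounds : 2 * N <= N * N /\ 2 <= N.
Proof. by rewrite leq_mul2r defN; lia. Qed.

Lemma addr_eval M w s k e i : rep M w s -> k < stride -> i < N ->
  expr_eval W S s e = Some i ->
  expr_eval W S s (addr k e) = Some (2 * m + 2 + stride * i + k).
Proof.
move=> [[_ Hm] _ _ _] kK iN /= ->; have [h1 h2] := size_bounds; have h0 := leW.
rewrite /stride in kK iN *.
have -> /= : k.+2 < W by lia.
have -> /= : 1 < W by lia.
have -> /= : 2 < W by lia.
have -> /= : 1 < S by lia.
rewrite Hm.
have -> /= : 2 * m < W by lia.
have -> /= : k.+2 + 2 * m < W by lia.
have -> /= : 32 < W by lia.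
have -> /= : 32 * i < W by lia.
have -> /= : k.+2 + 2 * m + 32 * i < W by lia.
by congr Some; lia.
Qed.

Lemma comp_eval M w s e : rep M w s -> ok M e ->
  expr_eval W S s (comp e) = Some (den M e).
Proof.
move=> H; have [[Hn Hm] He HM _] := H; have [h1 h2] := size_bounds; have h0 := leW.
have hS : 2 * m + 64 < S by rewrite /stride; lia.
elim: e => [c|||k e IH|e IH|e IH|o e1 IH1 e2 IH2] hok.
- by move: hok => /= hc; have -> : c < W by lia.
- rewrite /=; have -> /= : 0 < W by lia.
  have -> /= : 0 < S by lia.
  by rewrite Hn.
- rewrite /=; have -> /= : 1 < W by lia.
  have -> /= : 1 < S by lia.
  by rewrite Hm.
- move: hok => /= -[kK [hok lN]].
  change (obind (fun i => guard (i < S) (imem s i))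
    (expr_eval W S s (addr k (comp e))) = Some (M k (den M e))).
  rewrite (addr_eval H kK lN (IH hok)) /= HM //.
  by have -> : 2 * m + 2 + stride * den M e + k < S
    by move: kK lN; rewrite /stride; lia.
- move: hok => /= -[hok lm]; rewrite (IH hok) /=.
  have -> /= : 2 < W by lia.
  have -> /= : 2 * den M e < W by lia.
  have -> /= : 2 + 2 * den M e < W by lia.
  have -> /= : 2 + 2 * den M e < S by lia.
  by rewrite add2n (He _ lm).1.
- move: hok => /= -[hok lm]; rewrite (IH hok) /=.
  have -> /= : 3 < W by lia.
  have -> /= : 2 < W by lia.
  have -> /= : 2 * den M e < W by lia.
  have -> /= : 3 + 2 * den M e < W by lia.
  have -> /= : 3 + 2 * den M e < S by lia.
  by rewrite add3n (He _ lm).2.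
- by move: hok => /= -[[/IH1-> /IH2->] /= ->].
Qed.

Arguments comp : simpl never.

(** * Rules for budgeted runs *)

Definition post := (nat -> nat -> nat) -> (nat -> R) -> nat -> Prop.

(* The budget b counts basic commands; each takes at most unit_cost time. *)
Definition run (c : cmd) M w (b : nat) (Q : post) : Prop :=
  forall s, rep M w s -> exists t s' M' w' b',
    [/\ exec W S c s t s', rep M' w' s',
        t + unit_cost * b' <= unit_cost * b & Q M' w' b'].

Lemma run_weaken c M w b (Q Q' : post) :
  run c M w b Q -> (forall M w b, Q M w b -> Q' M w b) -> run c M w b Q'.
Proof.
move=> H HQ s /H[t [s' [M' [w' [b' [h1 h2 h3 h4]]]]]].
by exists t, s', M', w', b'; split=> //; apply: HQ.
Qed.

Lemma run_seq c1 c2 M w b (Q : post) :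
  run c1 M w b (fun M w b => run c2 M w b Q) -> run (Seq c1 c2) M w b Q.
Proof.
move=> H s /H[t [s' [M' [w' [b' [h1 h2 h3]]]]]].
move=> /(_ _ h2)[t' [s'' [M'' [w'' [b'' [h1' h2' h3' h4']]]]]].
exists (t + t'), s'', M'', w'', b''; split=> //; first exact: ExecSeq h1 h1'.
by lia.
Qed.

Lemma run_skip M w b (Q : post) : 0 < b -> Q M w b.-1 -> run Skip M w b Q.
Proof.
move=> b0 HQ s Hs; exists 1, s, M, w, b.-1; split=> //; first exact: ExecSkip.
by rewrite /unit_cost; lia.
Qed.

Lemma run_set k e1 e2 M w b (Q : post) :
  0 < b -> k < stride -> ok M e1 -> den M e1 < N -> ok M e2 ->
  (expr_time (addr k (comp e1)) + expr_time (comp e2)).+1 <= unit_cost ->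
  Q (upd M k (den M e1) (den M e2)) w b.-1 ->
  run (hset k e1 e2) M w b Q.
Proof.
move=> b0 kK ok1 l1 ok2 cost HQ s Hs; have [[Hn Hm] He HM Hw] := Hs.
have lS : 2 * m + 2 + stride * den M e1 + k < S.
  by move: kK; rewrite /stride; lia.
set i := 2 * m + 2 + stride * den M e1 + k.
exists (expr_time (addr k (comp e1)) + expr_time (comp e2)).+1.
exists (State [eta imem s with i |-> den M e2] (wmem s)).
exists (upd M k (den M e1) (den M e2)), w, b.-1; split=> //.
- apply: ExecStore => //; first exact: addr_eval Hs kK l1 (comp_eval Hs ok1).
  exact: comp_eval Hs ok2.
- split=> //=.
  + by split; case: eqP => // ?; lia.
  + by move=> j jm; split; (case: eqP => [?|_]; first lia); case: (He _ jm).
  + move=> k' i' kK'; rewrite HM // /upd; case: eqP => [E|E].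
      have Ek : k' = k by move: E kK kK'; rewrite /i /stride; lia.
      have -> : i' = den M e1 by move: E; rewrite Ek /i /stride; lia.
      by rewrite Ek eqxx (introT eqnP (erefl k)).
    case: eqnP => // Ek; case: eqP => // Ei; case: E.
    by rewrite Ek Ei.
- by move: cost; rewrite /unit_cost; lia.
Qed.

Lemma run_wset e r x M w b (Q : post) :
  0 < b -> ok M e -> den M e < 2 * N ->
  (forall s, rep M w s -> wexpr_eval W S s r = Some x) ->
  (expr_time (comp e) + wexpr_time r).+1 <= unit_cost ->
  Q M [eta w with den M e |-> x] b.-1 ->
  run (WStore (comp e) r) M w b Q.
Proof.
move=> b0 ok1 l1 ev cost HQ s Hs; have [Hnm He HM Hw] := Hs.
exists (expr_time (comp e) + wexpr_time r).+1.
exists (State (imem s) [eta wmem s with den M e |-> x]).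
exists M, [eta w with den M e |-> x], b.-1; split=> //.
- apply: ExecWStore (ev _ Hs); first exact: comp_eval Hs ok1.
  by rewrite /stride; lia.
- by split=> //= i; rewrite Hw.
- by move: cost; rewrite /unit_cost; lia.
Qed.

Lemma wread_eval M w s e : rep M w s -> ok M e -> den M e < 2 * N ->
  wexpr_eval W S s (WRead (comp e)) = Some (w (den M e)).
Proof.
move=> Hs oke l; rewrite /= (comp_eval Hs oke) /=.
have -> : den M e < S by rewrite /stride; lia.
by case: Hs => _ _ _ ->.
Qed.

Lemma run_wcopy e e1 M w b (Q : post) :
  0 < b -> ok M e -> den M e < 2 * N -> ok M e1 -> den M e1 < 2 * N ->
  (expr_time (comp e) + (expr_time (comp e1)).+1).+1 <= unit_cost ->
  Q M [eta w with den M e |-> w (den M e1)] b.-1 ->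
  run (WStore (comp e) (WRead (comp e1))) M w b Q.
Proof.
move=> b0 ok0 l0 ok1 l1 cost HQ; apply: (run_wset (r := WRead (comp e1)) b0 ok0 l0 _ cost HQ) => s Hs.
exact: wread_eval.
Qed.

Lemma run_wadd e e1 e2 M w b (Q : post) :
  0 < b -> ok M e -> den M e < 2 * N -> ok M e1 -> den M e1 < 2 * N ->
  ok M e2 -> den M e2 < 2 * N ->
  (expr_time (comp e) + ((expr_time (comp e1)).+1 + (expr_time (comp e2)).+1).+1).+1
    <= unit_cost ->
  Q M [eta w with den M e |-> (w (den M e1) + w (den M e2))%R] b.-1 ->
  run (WStore (comp e) (WAdd (WRead (comp e1)) (WRead (comp e2)))) M w b Q.
Proof.
move=> b0 ok0 l0 ok1 l1 ok2 l2 cost HQ; apply: (run_wset (r := WAdd (WRead (comp e1)) (WRead (comp e2))) b0 ok0 l0 _ cost HQ).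
move=> s Hs.
by have := wread_eval Hs ok1 l1; have := wread_eval Hs ok2 l2 => /= -> ->.
Qed.

Lemma run_if e c1 c2 M w b (Q : post) :
  0 < b -> ok M e -> (expr_time (comp e)).+1 <= unit_cost ->
  (den M e != 0 -> run c1 M w b.-1 Q) ->
  (den M e = 0 -> run c2 M w b.-1 Q) ->
  run (If (comp e) c1 c2) M w b Q.
Proof.
move=> b0 oke cost H1 H2 s Hs.
have : run (if den M e != 0 then c1 else c2) M w b.-1 Q.
  by case: (altP (den M e =P 0)) => h /=; [exact: H2 | exact: H1].
case/(_ _ Hs) => t [s' [M' [w' [b' [h1 h2 h3 h4]]]]].
exists (expr_time (comp e) + t).+1, s', M', w', b'; split=> //.
  exact: ExecIf (comp_eval Hs oke) h1.
by move: cost h3; rewrite /unit_cost; lia.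
Qed.

(* Every test costs budget, so loops terminate by induction on the budget. *)
Lemma run_while (I : post) e c M w b (Q : post) :
  (expr_time (comp e)).+1 <= unit_cost ->
  (forall M w b, I M w b -> [/\ 0 < b, ok M e,
     den M e != 0 -> run c M w b.-1 I & den M e = 0 -> Q M w b.-1]) ->
  I M w b -> run (While (comp e) c) M w b Q.
Proof.
move=> cost HI; have [B] := ubnP b; elim: B b M w => // B IH b M w ltB Hb.
have [b0 oke H1 H2] := HI _ _ _ Hb => s Hs.
case: (altP (den M e =P 0)) => [E|E].
  exists (expr_time (comp e)).+1, s, M, w, b.-1; split=> //.
  - by apply: ExecWhileDone; rewrite (comp_eval Hs oke) E.
  - by move: cost; rewrite /unit_cost; lia.
  - exact: H2.
have [t [s1 [M1 [w1 [b1 [h1 h2 h3 h4]]]]]] := H1 E s Hs.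
have lb : b1 < B by move: h3; rewrite /unit_cost; lia.
have [t' [s' [M' [w' [b' [h1' h2' h3' h4']]]]]] := IH _ _ _ lb h4 s1 h2.
exists (expr_time (comp e) + t + t').+1, s', M', w', b'; split=> //.
  exact: ExecWhileStep (comp_eval Hs oke) E h1 h1'.
by move: cost h3 h3'; rewrite /unit_cost; lia.
Qed.

Lemma run_budget c M w b b' Q : b <= b' -> run c M w b Q -> run c M w b' Q.
Proof.
move=> le H s /H[t [s' [M' [w' [b'' [h1 h2 h3 h4]]]]]].
by exists t, s', M', w', b''; split=> //; move: h3; rewrite /unit_cost; lia.
Qed.

(** A frame rule: budget set aside before a command is still there after it. *)
Lemma run_add c M w b x Q :
  run c M w b (fun M w b' => Q M w (b' + x)) -> run c M w (b + x) Q.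
Proof.
move=> H s /H[t [s' [M' [w' [b' [h1 h2 h3 h4]]]]]].
by exists t, s', M', w', (b' + x); split=> //; move: h3; rewrite /unit_cost; lia.
Qed.

Lemma den_lt M e1 e2 :
  (den M (HB Lt e1 e2) != 0) = (den M e1 < den M e2).
Proof. by rewrite /=; case: (_ < _). Qed.

(** The [2 * B + 2] pays for a test and an increment per round, the initialisation and the last
    test; the rounds themselves are paid through [I]. *)
Lemma run_for (I : nat -> post) k bound B body M w b (Q : post) :
  k < stride -> (bound = HN /\ B = n \/ bound = HM /\ B = size es) ->
  (forall i M w b, i < B -> M k 0 = i -> I i M w b ->
    run body M w b (fun M' w' b' => M' k 0 = i /\ I i.+1 (upd M' k 0 i.+1) w' b')) ->
  I 0 (upd M k 0 0) w b ->
  (forall M w b, I B M w b -> Q M w b) ->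
  run (for_loop k bound body) M w (b + 2 * B + 2) Q.
Proof.
move=> kK hB Hbody H0 HQ.
have oB M' : ok M' bound by case: hB => -[-> _].
have dB M' : den M' bound = B by case: hB => -[-> ->].
have NB : B < N by case: hB => -[_ ->]; have := defN; lia.
have [WN N2] := size_bounds; have leW' := leW.
apply: run_seq; apply: run_set => //=; try lia.
pose J : post := fun M w b => exists i b', [/\ i <= B, M k 0 = i,
  I i M w b' & b = b' + (2 * (B - i) + 1)].
apply: (@run_while J); last first.
- by exists 0, b; split=> //=; rewrite ?subn0; [rewrite /upd (introT eqnP (erefl k)) | lia].
- move=> M' w' b'; case=> i [b'' [iB Mi Ii ->]]; split; first lia.
  + rewrite /=; repeat split => //; try lia.
  + rewrite den_lt dB /= Mi => ltiB; apply: run_seq.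
    have -> : (b'' + (2 * (B - i) + 1)).-1 = b'' + (2 * (B - i.+1) + 2) by lia.
    apply: run_add; apply: run_weaken (Hbody i _ _ _ ltiB Mi Ii) _.
    move=> M1 w1 b1 [Mi1 Ii1]; apply: run_set => //=; rewrite ?Mi1 /=; try lia.
    by exists i.+1, b1; split=> //=; rewrite ?addn1 //;
      [rewrite /upd (introT eqnP (erefl k)) | lia].
  + move=> /eqP; rewrite -[_ == _]negbK den_lt dB /= Mi => leBi.
    have iE : i = B by lia.
    by apply: HQ; rewrite iE in Ii *; move: Ii; congr I; lia.
- by case: hB => -[-> _].
Qed.


(** * Word bounds and frame conditions *)

Arguments upd M k i x k' i' /.

Ltac side :=
  lazymatch goal with
  | |- is_true _ => lia
  | |- _ /\ _ => by repeat (split => //); lia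
  | |- _ => idtac
  end.

(** Entries of [SUM] are bounded by [n * m], which is why words must hold quadratic values. The
    bounds are linear once [n * m] is treated as an atom. *)
Lemma word_bounds : [/\ 64 * N <= W, 4 * (n * m) + 4 * N <= W, 1 < N & N = n + m + 2].
Proof.
have := leW; rewrite defN => le; split=> //; last by lia.
  by apply: leq_trans le; rewrite leq_mul2l leq_pmulr //; lia.
by apply: leq_trans le; rewrite !mulnDl !mulnDr; lia.
Qed.

Lemma bool_word (c : bool) : c < W.
Proof. by have [WN _ N2 _] := word_bounds; case: c; lia. Qed.

Definition same (fs : seq nat) (M0 M : nat -> nat -> nat) : Prop :=
  forall k i, k \notin fs -> M k i = M0 k i.

Lemma same_upd fs M0 M k i x : k \in fs -> same fs M0 M -> same fs M0 (upd M k i x).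
Proof.
move=> kf H k' i' nk'; rewrite /upd; case: eqnP => [E|_]; last exact: H.
by rewrite E kf in nk'.
Qed.

Lemma same_weak fs fs' M M' : {subset fs <= fs'} -> same fs M M' -> same fs' M M'.
Proof. by move=> sf H k i nk; apply: H; apply: contra nk => /sf. Qed.

Lemma same_trans fs M1 M2 M3 : same fs M1 M2 -> same fs M2 M3 -> same fs M1 M3.
Proof. by move=> h1 h2 k i kf; rewrite h2 // h1. Qed.

(** * Reading the edges into the arrays *)

Definition is_edge_list (L : seq ('I_n * 'I_n)) M : Prop :=
  forall p, p < size L -> M TAIL p = nth 0 [seq val e.1 | e <- L] p /\
                          M HEAD p = nth 0 [seq val e.2 | e <- L] p.

(* One plus the number of the last edge with tail v before edge i, or 0. *)
Fixpoint last_out (v : nat) (i : nat) : nat :=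
  if i is j.+1 then if tl j == v then i else last_out v j else 0.

Lemma last_out_le v i : last_out v i <= i.
Proof. by elim: i => //= i IH; case: ifP => // _; apply: leqW. Qed.

Definition degs (l : seq ('I_n * 'I_n)) v := \sum_(e <- l) incident v e.

Definition sums (l : seq ('I_n * 'I_n)) v :=
  \sum_(e <- l | incident v e) val (other v e).

Definition heads (l : seq ('I_n * 'I_n)) v := count (fun e => e.2 == v) l.

Lemma size_nth (l : seq ('I_n * 'I_n)) i : i < size l -> exists x : 'I_n * 'I_n,
  [/\ x \in l, take i.+1 l = rcons (take i l) x, drop i l = x :: drop i.+1 l
    & forall U (d : U) f, nth d (map f l) i = f x].
Proof.
case: l => [|x0 l] // li; exists (nth x0 (x0 :: l) i); split.
- exact: mem_nth.
- exact: take_nth.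
- exact: drop_nth.
- by move=> U d f; rewrite (nth_map x0).
Qed.

Lemma degs_le l v : degs l v <= size l.
Proof. by rewrite -sum1_size; apply: leq_sum => e _; case: incident. Qed.

Lemma sums_le l v : sums l v <= n * size l.
Proof.
rewrite -sum1_size big_distrr /= /sums [X in X <= _]big_mkcond.
apply: leq_sum => e _; case: incident => //; rewrite muln1.
exact: ltnW (ltn_ord _).
Qed.

Definition scanned (i : nat) (M0 M : nat -> nat -> nat) : Prop :=
  [/\ same [:: vI; NEXT; FIRST; INDEG; DEG; SUM] M0 M,
      forall v : 'I_n, M FIRST v = last_out v i,
      forall e, e < i -> M NEXT e = last_out (tl e) e &
      forall v : 'I_n, [/\ M INDEG v = heads (take i es) v,
        M DEG v = degs (take i es) v & M SUM v = sums (take i es) v]].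

Lemma run_scan_edges M0 w0 b Q :
  (forall k i, M0 k i = 0) -> (forall e, e \in es -> e.1 != e.2) ->
  (forall M, scanned m M0 M -> Q M w0 b) ->
  run scan_edges M0 w0 (b + 9 * m + 2) Q.
Proof.
move=> M00 noloop HQ; have [WN WB N2 dN] := word_bounds.
have -> : b + 9 * m + 2 = (b + 7 * m) + 2 * m + 2 by lia.
apply: (@run_for (fun i M w b' => [/\ w = w0, b' = b + 7 * (m - i) & scanned i M0 M])).
- by [].
- by right.
- move=> i M w b' lim Mi [-> -> [sM MF MN MV]].
  have [x [xes tk _ nx]] := size_nth lim.
  have tE : tl i = x.1 by rewrite /tl nx.
  have hE : hd i = x.2 by rewrite /hd nx.
  have x12 : (x.1 == x.2 :> nat) = false by apply: negbTE; apply: noloop.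
  have l1 := ltn_ord x.1; have l2 := ltn_ord x.2.
  have [e8 _ _] := MV x.2; have [_ e14 e15] := MV x.1; have [_ f14 f15] := MV x.2.
  have x21 : (x.2 == x.1 :> nat) = false by rewrite eq_sym.
  have szt : size (take i es) = i by rewrite size_take lim.
  have b8 : M INDEG x.2 <= i by rewrite e8 -[leqRHS]szt count_size.
  have b14 : M DEG x.1 <= i by rewrite e14 -[leqRHS]szt degs_le.
  have c14 : M DEG x.2 <= i by rewrite f14 -[leqRHS]szt degs_le.
  have b15 : M SUM x.1 <= n * m.
    by rewrite e15 (leq_trans (sums_le _ _)) // leq_mul2l szt ltnW // orbT.
  have c15 : M SUM x.2 <= n * m.
    by rewrite f15 (leq_trans (sums_le _ _)) // leq_mul2l szt ltnW // orbT.
  do 6![(apply: run_seq; apply: run_set) => //=; rewrite ?Mi ?tE ?hE ?x12 ?x21; try side].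
  apply: run_set => //=; rewrite ?Mi ?tE ?hE ?x12 ?x21; try side.
  split=> //; split=> //; first lia.
  have incx v : incident v x = (v == x.1) + (v == x.2) :> nat.
    rewrite /incident ![v == _]eq_sym; case: eqP => // <-.
    by case: eqP => // E; rewrite -E eqxx in x12.
  split.
  + by do ![apply: same_upd => //].
  + by move=> v /=; rewrite tE addn1 eq_sym; case: eqP.
  + move=> e /=; rewrite ltnS leq_eqVlt => /predU1P[->|lt].
      by rewrite eqxx MF tE.
    by rewrite ltn_eqF // MN.
  + move=> v /=; have [h1 h2 h3] := MV v; rewrite tk /heads /degs /sums.
    rewrite -!cats1 count_cat !big_cat /= !big_cons !big_nil /= !incx !val_eqE.
    rewrite -/(heads _ v) -/(degs _ v) -/(sums _ v) -h1 -h2 -h3.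
    rewrite /other /incident ![v == _]eq_sym !addn0.
    have X12 : (x.1 == x.2) = false := x12.
    case: (eqVneq x.2 v) => [<-|_]; first by rewrite X12 orbT addn1.
    by case: (eqVneq x.1 v) => [<-|_] /=; rewrite ?addn0 ?addn1.
- split=> //; first by rewrite subn0.
  split=> [|v|//|v] /=; first by apply: same_upd.
    by rewrite M00.
  by rewrite !M00 /heads /degs /sums take0 !big_nil.
- by move=> M w b' [-> -> HM]; rewrite subnn muln0 addn0; apply: HQ.
Qed.

(** * Topological sorting with a queue *)

Definition is_queue (q : seq 'I_n) M : Prop :=
  M vC 0 = size q /\ forall p, p < size q -> M QUEUE p = nth 0 (map val q) p.

Lemma is_queue_rcons q x M : is_queue q M ->
  is_queue (rcons q x) (upd (upd M QUEUE (size q) (val x)) vC 0 (size q).+1).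
Proof.
move=> [h1 h2]; split=> /=; first by rewrite size_rcons.
move=> p; rewrite size_rcons ltnS leq_eqVlt map_rcons nth_rcons size_map.
by case: eqVneq => [->|_] /=; [rewrite ltnn ?eqxx | move=> lt; rewrite lt h2].
Qed.

Lemma run_enqueue_sources M0 w0 b Q :
  (forall v : 'I_n, M0 INDEG v = heads es v) ->
  (forall q M b', b <= b' -> uniq q -> (forall v, (v \in q) = (heads es v == 0)) ->
     is_queue q M -> same [:: vI; vC; QUEUE] M0 M -> Q M w0 b') ->
  run enqueue_sources M0 w0 (b + 5 * n + 3) Q.
Proof.
move=> ind HQ; have [WN WB N2 dN] := word_bounds.
apply: run_seq; apply: run_set => //=; try side.
have -> : (b + 5 * n + 3).-1 = b + 3 * n + 2 * n + 2 by lia.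
pose I i M w b' := exists q : seq 'I_n, [/\ w = w0, b + 3 * (n - i) <= b', uniq q /\ is_queue q M,
  forall v : 'I_n, (v \in q) = (v < i) && (heads es v == 0)
  & same [:: vI; vC; QUEUE] M0 M].
apply: (@run_for I) => //; first by left.
- move=> i M w b' lin Mi [q [-> lb [uq [h1 h2]] qv sM]].
  pose v := Ordinal lin.
  have vi : val v = i by [].
  have Mv : M INDEG i = heads es v by rewrite sM //; apply: (ind v).
  have vq : v \notin q by rewrite qv /= ltnn.
  have sq : size q < n.
    by have := card_uniqP (s := v :: q); rewrite /= vq => /(_ uq) <-; rewrite -[leqRHS]card_ord max_card.
  have ltv (u : 'I_n) : (u < i.+1) = (u == v) || (u < i) by rewrite ltnS leq_eqVlt.
  apply: run_if => //=; rewrite ?Mi ?Mv; try side.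
  + case: (eqVneq (heads es v) 0) => // h0 _.
    apply: run_seq; apply: run_set => //=; rewrite ?Mi ?h1; try side.
    apply: run_set => //=; rewrite ?Mi ?h1; try side.
    split=> //; exists (rcons q v); split=> //.
    * lia.
    * rewrite rcons_uniq vq uq; split=> //.
      have [g1 g2] := is_queue_rcons v (conj h1 h2).
      by split=> //=; rewrite -?g1 /= ?addn1.
    * by move=> u; rewrite mem_rcons inE qv ltv; case: (eqVneq u v) => [->|] //=; rewrite h0.
    * by do ![apply: same_upd => //].
  + case: (eqVneq (heads es v) 0) => // h0 _; apply: run_skip; first lia.
    split=> //; exists q; split=> //; first lia.
    * move=> u; rewrite qv ltv; case: (eqVneq u v) => [->|] //=.
      by rewrite ltnn (negPf h0).
    * by apply: same_upd.
- exists [::]; split=> //=; first lia.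
  by do ![apply: same_upd => //].
- move=> M w b' [q [-> lb [uq qM] qv sM]]; apply: (HQ q) => //; first lia.
  by move=> v; rewrite qv ltn_ord.
Qed.

(** Following [NEXT] misses nothing: no edge with tail [v] lies between two consecutive entries of
    the list of [v]. *)
Lemma last_outP v k :
  (forall j, last_out v k <= j < k -> tl j != v) /\
  (0 < last_out v k -> tl (last_out v k).-1 = v).
Proof.
elim: k => [|k [IH1 IH2]] /=; first by split=> // j; rewrite andbF.
case: (eqVneq (tl k) v) => [E|ne].
  by split=> // j /andP[h1 h2]; lia.
split=> // j; rewrite ltnS => /andP[h1]; rewrite leq_eqVlt => /predU1P[->//|h2].
by apply: IH1; rewrite h1.
Qed.

Lemma tl_index (e : 'I_n * 'I_n) : e \in es -> tl (index e es) = e.1.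
Proof. by move=> ees; rewrite /tl (nth_map e) ?nth_index ?index_mem. Qed.

Definition kahn_fields : seq nat :=
  [:: vI; vJ; vE; vC; vX; vV; INDEG; QUEUE; TAIL; HEAD].

Definition kahn_state M0 (q : seq 'I_n) (L : seq ('I_n * 'I_n)) M : Prop :=
  [/\ kahn_inv es q L, is_queue q M, M vJ 0 = size L /\ is_edge_list L M,
      forall v : 'I_n, M INDEG v = pending es L v & same kahn_fields M0 M].

Definition kahn_link M0 : Prop :=
  (forall v : 'I_n, M0 FIRST v = last_out v m) /\
  (forall e, e < m -> M0 NEXT e = last_out (tl e) e).

Lemma pending_le L (v : 'I_n) : pending es L v <= m.
Proof. exact: count_size. Qed.

(** Pure symbolic execution, kept apart from the sorting invariant. The longest path has 10
    commands: seven assignments, a test and the two of [push]. *)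
Lemma run_emit_mem M w b (p h v j d c : nat) (Q : post) :
  M vE 0 = p.+1 -> M vV 0 = v -> M vJ 0 = j -> hd p = h -> M INDEG h = d.+1 ->
  M vC 0 = c -> p < m -> v < n -> h < n -> j < m -> c < n -> d < m ->
  (let M1 := upd (upd (upd (upd (upd (upd M vE 0 p) vX 0 h) TAIL j v) HEAD j h)
               vJ 0 j.+1) INDEG h d in
   let M2 := if d == 0 then upd (upd M1 QUEUE c h) vC 0 c.+1 else M1 in
   forall b', b <= b' -> Q (upd M2 vE 0 (M NEXT p)) w b') ->
  run emit M w (b + 10) Q.
Proof.
move=> ME MV MJ hE Mh MC pm vn hn jm cn dm HQ; have [WN WB N2 dN] := word_bounds.
do 6![(apply: run_seq; apply: run_set) => //=; rewrite ?ME ?subn1 /= ?hE ?MJ ?MV ?Mh ?addn1;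
  try side].
apply: run_seq; apply: run_if => //=; rewrite ?eqxx; try side; case: (eqVneq d 0) => // d0 _.
  apply: run_seq; apply: run_set => //=; rewrite ?MC; try side.
  apply: run_set => //=; rewrite ?MC ?addn1; try side.
  apply: run_set => //=; try side.
  by move: HQ; rewrite d0 /=; apply; lia.
apply: run_skip; first lia.
apply: run_set => //=; try side.
by move: HQ; rewrite (negPf d0) /=; apply; lia.
Qed.

(** The list of [v] runs through decreasing edge numbers, so the edges of [v] emitted so far are
    those numbered above [p]. The budget is demanded only under [size L < m], a fact that the proof
    derives from the current edge not being in [L]. *)
Lemma run_emit M0 w0 q L M b b0 (i : nat) (v : 'I_n) (p : nat) (Q : post) :
  uniq es -> (forall e, e \in es -> e.1 != e.2) -> kahn_link M0 ->
  kahn_state M0 q L M -> M vI 0 = i -> M vV 0 = v -> M vE 0 = p.+1 ->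
  i < size q -> nth v q i = v -> tl p = v -> p < m ->
  (forall e, e \in es -> (e \in L) =
     (e.1 \in take i q) || (e.1 == v) && (p < index e es)) ->
  (forall M' q' x b', b <= b' -> [/\ kahn_state M0 q' (rcons L x) M', M' vI 0 = i, M' vV 0 = v,
     M' vE 0 = last_out v p & [/\ size q <= size q', nth v q' i = v, size L < m,
     take i q' = take i q &
     forall e, e \in es -> (e \in rcons L x) =
     (e.1 \in take i q') || (e.1 == v) && (p <= index e es)]] -> Q M' w0 b') ->
  (size L < m -> b + 10 <= b0) -> run emit M w0 b0 Q.
Proof.
move=> ues noloop [MF MN] [kinv [Mq1 Mq2] [MJ ML] Mi sM] MI MV ME iq qi tlp pm Lq HQ lb0.
have [x [xes _ _ nx]] := size_nth pm.
have hE : hd p = x.2 by rewrite /hd nx.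
have tE : x.1 = v by apply: val_inj; rewrite /= -tlp /tl nx.
have px : p = index x es.
  have := nx _ x id; rewrite map_id => <-; by rewrite index_uniq.
have [uq [uL sL] qP Lord Lsort] := kinv.
have x1q : x.1 \in q by rewrite tE -qi mem_nth.
have ix : index x.1 q = i by rewrite tE -qi index_uniq.
have xL : x \notin L.
  by rewrite Lq // -px ltnn andbF orbF in_take // ix ltnn.
have Lle e : e \in L -> index e.1 q <= index x.1 q.
  move=> eL; have [e1q _] := Lord _ eL; rewrite ix.
  have := Lq e (sL _ eL); rewrite eL in_take // => /esym/orP[/ltnW//|/andP[/eqP-> _]].
  by rewrite -tE ix.
have [x2q kinv'] := kahn_emit ues kinv xes xL x1q Lle.
have sLm : size L < m.
  rewrite -(size_rcons L x) uniq_leq_size ?rcons_uniq ?xL // => e.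
  by rewrite mem_rcons inE => /predU1P[->|/sL].
have sqn : size q < n.
  have /card_uniqP /= <- : uniq (x.2 :: q) by rewrite /= x2q.
  by rewrite -[leqRHS]card_ord max_card.
have pr := pending_rcons ues _ xes xL.
have Mx2 := Mi x.2; rewrite pr eqxx add1n in Mx2.
have [pp ppE ppm] : exists2 pp, pp = pending es (rcons L x) x.2 & pp < m.
  exists (pending es (rcons L x) x.2) => //.
  by have := pending_le L x.2; rewrite pr eqxx.
rewrite -ppE in Mx2 kinv'.
apply: (run_budget (lb0 sLm)); apply: (run_emit_mem (p := p) (h := x.2) (v := v) (j := size L) (d := pp)
  (c := size q)) => // M1 M2 b' lb.
set q' := (if pp == 0 then _ else _) in kinv'.
have sq' : size q <= size q' by rewrite /q'; case: ifP; rewrite ?size_rcons.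
have nq' : nth v q' i = v by rewrite /q'; case: ifP => _ //; rewrite nth_rcons iq qi.
have tq' : take i q' = take i q.
  by rewrite /q'; case: ifP => // _; rewrite -cats1 takel_cat // ltnW.
have M1L : is_edge_list (rcons L x) M1.
  move=> j; rewrite /M1 size_rcons ltnS leq_eqVlt !map_rcons !nth_rcons !size_map /=.
  case: (eqVneq j (size L)) => [->|ne] /=; first by rewrite ltnn tE.
  by move=> lt; rewrite lt; apply: ML.
have M1i (u : 'I_n) : M1 INDEG u = pending es (rcons L x) u.
  rewrite /M1 /= val_eqE; case: (eqVneq u x.2) => [->|ne]; first exact: ppE.
  by rewrite Mi pr [x.2 == u]eq_sym (negPf ne).
have M1s : same kahn_fields M0 M1 by rewrite /M1; do ![apply: same_upd => //].
have M1q : is_queue q M1 by split.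
have M1J : M1 vJ 0 = size (rcons L x) by rewrite size_rcons.
have [M1I M1V M1E] : [/\ M1 vI 0 = i, M1 vV 0 = v & M1 vE 0 = p] by [].
have MNp : M NEXT p = last_out v p by rewrite sM // MN // tlp.
clearbody M1; rewrite {}MNp.
have M2q : is_queue q' M2.
  rewrite /M2 /q'; case: ifP => // _; exact: is_queue_rcons.
have M2E k j : k \notin [:: vC; QUEUE] -> M2 k j = M1 k j.
  rewrite /M2; case: ifP => // _; rewrite !inE => /norP[k1 k2].
  by rewrite /upd; do 2![case: eqnP => [E|_]; first by rewrite E in k1 k2].
apply: (HQ _ q' x _ lb); split; rewrite /= ?M2E //.
  split=> //=.
  - split; first by rewrite /= M2E.
    by move=> j /M1L; rewrite /= !M2E.
  - by move=> u; rewrite /= M2E.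
  - apply: same_upd => //; rewrite /M2; case: ifP => // _.
    by do 2!apply: same_upd => //.
split=> // e ees; rewrite tq' mem_rcons inE Lq // [p <= _]leq_eqVlt {2}px.
case: (eqVneq e x) => [->|ne] /=; first by rewrite tE eqxx [index x es == _]eqxx orbT.
suff -> : (index x es == index e es) = false by [].
apply/eqP => E; have := nth_index x ees; rewrite -E nth_index // => xe.
by rewrite xe eqxx in ne.
Qed.

Lemma run_sort_edges (G : digraph 'I_n) M0 w0 b q0 (Q : post) :
  acyclic G -> (forall x y, ((x, y) \in es) = arc G x y) -> uniq es ->
  kahn_link M0 -> uniq q0 -> is_queue q0 M0 ->
  (forall v : 'I_n, (v \in q0) = (heads es v == 0)) ->
  (forall v : 'I_n, M0 INDEG v = heads es v) ->
  (forall q L M b', b <= b' -> kahn_inv es q L -> perm_eq L es ->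
     is_edge_list L M -> same kahn_fields M0 M -> Q M w0 b') ->
  run sort_edges M0 w0 (b + 5 * n + 11 * m + 3) Q.
Proof.
move=> acG esG ues link uq0 Mq0 q0P M0i HQ; have [WN WB N2 dN] := word_bounds.
have noloop e : e \in es -> e.1 != e.2.
  by case: e => x y; rewrite esG /=; apply: contraTneq => ->; rewrite (arc_irrefl G).
have start L M : kahn_state M0 q0 L M -> size q0 <= n.
  by move=> _; rewrite -[leqRHS]card_ord -(card_uniqP uq0) max_card.
apply: run_seq; apply: run_set => //=; try side.
apply: run_seq; apply: run_set => //=; try side.
set M1 := upd _ vI 0 0.
(* A queued vertex costs 5: the outer test, two assignments, the failing inner test and the
   increment. An edge costs 11: the inner test and the 10 of [emit]. *)
pose slack (i : nat) (L : seq ('I_n * 'I_n)) := b + 5 * (n - i) + 11 * (m - size L).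
pose O M w b' := exists i (q : seq 'I_n) (L : seq ('I_n * 'I_n)),
  [/\ w = w0, M vI 0 = i /\ i <= size q, kahn_state M0 q L M,
      forall e, e \in es -> (e \in L) = (e.1 \in take i q)
    & slack i L < b'].
have M1s : kahn_state M0 q0 [::] M1.
  split=> //.
  - split=> // v; rewrite q0P /pending /heads; congr (_ == 0); apply: eq_count => e.
    by rewrite in_nil andbT.
  - move=> v; rewrite /M1 /= M0i /pending /heads; apply: eq_count => e.
    by rewrite in_nil andbT.
  - by rewrite /M1; do 2!apply: same_upd => //.
apply: (run_while (I := O)) => //; last first.
  exists 0, q0, [::]; split=> //; first by move=> e; rewrite take0.
  by rewrite /slack /= !subn0; lia.
move=> M w b' [i [q [L [-> [Mi iq] Ms Lq lb]]]].
have [kinv [MC MQ] [MJ ML] Mind sM] := Ms.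
have [uq [uL sL] _ _ _] := kinv.
have sqn : size q <= n by rewrite -[leqRHS]card_ord -(card_uniqP uq) max_card.
have sLm : size L <= m by rewrite uniq_leq_size.
split.
- by apply: leq_trans lb.
- by rewrite /= Mi MC; repeat split => //; (exact: bool_word || lia).
- rewrite den_lt /= Mi MC => ltiq.
  have [v qi] : exists v : 'I_n, nth v q i = v.
    case: (q) ltiq => // v0 q' lti; exists (nth v0 (v0 :: q') i).
    by rewrite (set_nth_default v0).
  have Mv : M QUEUE i = v by rewrite MQ // (nth_map v) ?qi.
  have MF : M FIRST v = last_out v m by rewrite sM // link.1.
  have lv := ltn_ord v; have [lo1 lo2] := last_outP v m; have lo3 := last_out_le v m.
  have sl i' L' : slack i' L' = b + 5 * (n - i') + 11 * (m - size L') by [].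
  have sl' : slack i L = slack i.+1 L + 5 by rewrite !sl; lia.
  apply: run_seq; apply: run_set => //=; rewrite ?Mi ?Mv; try side; try lia.
  apply: run_seq; apply: run_set => //=; rewrite ?MF; try side; try lia.
  apply: run_seq.
  pose J M w b' := exists (q : seq 'I_n) (L : seq ('I_n * 'I_n)) (p : nat),
    [/\ w = w0, kahn_state M0 q L M, [/\ M vI 0 = i, M vV 0 = v & M vE 0 = p],
      [/\ i < size q, nth v q i = v, p <= m, 0 < p -> tl p.-1 = v &
        forall e, e \in es -> (e \in L) =
           (e.1 \in take i q) || (e.1 == v) && (p <= index e es)]
      & slack i.+1 L + 2 < b'].
  apply: (run_while (I := J)) => //; last first.
    exists q, L, (last_out v m); split=> //; last by lia.
      by split=> //; do 2!apply: same_upd => //.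
    split=> // e ees; rewrite Lq //; case: (e.1 \in _) => //=.
    apply/esym/negP => /andP[/eqP ev le]; have := lo1 (index e es).
    by rewrite le index_mem ees tl_index // ev eqxx => /(_ isT).
  move=> M' w' b'' [q' [L' [p [-> Ms' [h1 h2 h3] [g1 g2 g3 g4 g5] lb']]]].
  split; first by lia.
  + by rewrite /=; repeat split => //; lia.
  + rewrite /= h3; case: p h3 g3 g4 g5 => // p h3 g3 g4 g5 _.
    apply: (run_emit (b := slack i.+1 L' - 11 + 3) ues noloop link Ms' h1 h2 h3 g1 g2 (g4 isT) g3 g5).
      move=> M3 q3 x b3 lb3 [k1 k2 k3 k4 [k5 k6 k7 k8 k9]].
      have [lp1 lp2] := last_outP v p; have lp3 := last_out_le v p.
      exists q3, (rcons L' x), (last_out v p); split=> //.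
        split=> //; [exact: leq_trans g1 k5 | exact: leq_trans lp3 (ltnW g3) |].
        move=> e ees; rewrite k9 //; case: (e.1 \in _) => //=.
        case: eqP => //= ev; apply/idP/idP => [le|le]; first exact: leq_trans lp3 le.
        rewrite leqNgt; apply/negP => lt; have := lp1 (index e es).
        by rewrite le lt tl_index // ev eqxx => /(_ isT).
      by move: lb3; rewrite !sl size_rcons; lia.
    by move: lb'; rewrite !sl; lia.
  + rewrite /= h3 => p0; rewrite p0 in g5.
    apply: run_set => //=; rewrite ?h1; try side.
    exists i.+1, q', L'; split=> //=; first by rewrite addn1.
    * have [a1 a2 a3 a4 a5] := Ms'; split=> //.
      by apply: same_upd.
    * move=> e ees; rewrite g5 // (take_nth v) // g2 mem_rcons inE orbC.
      by rewrite leq0n andbT.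
    * by lia.
- move=> /eqP; rewrite -[_ == _]negbK den_lt /= Mi MC => lei.
  have {lei} iE : i = size q by apply/eqP; rewrite eqn_leq iq leqNgt.
  rewrite iE take_size in Lq; apply: (HQ q L) => //.
    by move: lb; rewrite /slack; lia.
  exact: kahn_complete acG esG kinv Lq.
Qed.

(** * Peeling on the counters of degrees and neighbour sums *)

Definition nbr_sum (A : {set 'I_n * 'I_n}) (v : 'I_n) : nat := \sum_(e in A | incident v e) val (other v e).

Definition alive (A : {set 'I_n * 'I_n}) M : Prop :=
  forall v : 'I_n, M DEG v = deg A v /\ M SUM v = nbr_sum A v.

Lemma deg_rem (A : {set 'I_n * 'I_n}) (v : 'I_n) e : e \in A -> deg A v = incident v e + deg (A :\ e) v.
Proof.
by move=> eA; rewrite /deg (big_setD1 e).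
Qed.

Lemma nbr_sum_rem (A : {set 'I_n * 'I_n}) (v : 'I_n) e : e \in A ->
  nbr_sum A v = (if incident v e then val (other v e) else 0) + nbr_sum (A :\ e) v.
Proof. by move=> eA; rewrite /nbr_sum big_mkcondr (big_setD1 e) //= -big_mkcondr. Qed.

Lemma deg_le (A : {set 'I_n * 'I_n}) (v : 'I_n) : deg A v <= #|A|.
Proof. by rewrite -sum1_card; apply: leq_sum => e _; case: incident. Qed.

Definition peel_step M (x y d s : nat) :=
  upd (upd (upd (upd (upd (upd M vY 0 y) DEG x 0) SUM x 0) DEG y d) SUM y (s - x)) vX 0 y.

Lemma run_peel_step M w b (x y d s : nat) (Q : post) :
  M vX 0 = x -> M SUM x = y -> M DEG y = d.+1 -> M SUM y = s -> x != y ->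
  x < n -> y < n -> d < N -> s <= 2 * (n * m) ->
  Q (peel_step M x y d s) w b ->
  run (Seq (setv vY (HF SUM (var vX)))
    (Seq (hset DEG (var vX) (HC 0))
    (Seq (hset SUM (var vX) (HC 0))
    (Seq (decr DEG (var vY))
    (Seq (subv SUM (var vY) (var vX))
         (setv vX (var vY))))))) M w (b + 6) Q.
Proof.
move=> MX Mx Md Ms /negPf xy xn yn dN' sN HQ; have [WN WB N2 dN] := word_bounds.
have yx : (y == x) = false by rewrite eq_sym.
do 5![(apply: run_seq; apply: run_set) => //=;
  rewrite ?MX ?Mx ?yx ?Md ?Ms ?subn1 /=; try side].
apply: run_set => //=; try side.
by have -> : (b + 6).-2.-2.-2 = b by lia.
Qed.

Lemma nbr_sum_le (A : {set 'I_n * 'I_n}) (v : 'I_n) : nbr_sum A v <= n * #|A|.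
Proof.
rewrite mulnC -sum_nat_const /nbr_sum big_mkcondr /=; apply: leq_sum => e _.
by case: incident => //; exact: ltnW (ltn_ord _).
Qed.

Lemma deg0_nbr_sum (A : {set 'I_n * 'I_n}) (v : 'I_n) : deg A v = 0 -> nbr_sum A v = 0.
Proof.
move=> d0; apply: big_pred0 => e; apply/negP => /andP[eA ve].
by have := deg_gt0 eA ve; rewrite d0.
Qed.

Lemma leaf_edge (A : {set 'I_n * 'I_n}) (x : 'I_n) : loopless A -> deg A x = 1 ->
  exists e (y : 'I_n), [/\ e \in A, x != y, nbr_sum A x = y,
    forall v : 'I_n, incident v e = (v == x) || (v == y) &
    other y e = x /\ deg (A :\ e) x = 0].
Proof.
move=> noloop d1.
have /set0Pn[e] : [set e in A | incident x e] != set0 by rewrite -card_gt0 -degE d1.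
rewrite inE => /andP[eA xe]; have := noloop e eA.
have d0 : deg (A :\ e) x = 0 by have := deg_rem x eA; rewrite d1 xe; lia.
case: e => u v in eA xe d0 *; move=> /= uv.
have sE : nbr_sum A x = val (other x (u, v)).
  by rewrite (nbr_sum_rem x eA) xe (deg0_nbr_sum d0) addn0.
have inc z : incident z (u, v) = (z == u) || (z == v).
  by rewrite /incident ![z == _]eq_sym.
exists (u, v); move: xe; rewrite inc => /orP[]/eqP xE.
  exists v; rewrite xE in sE d0 *; split=> //.
    by rewrite sE /other eqxx.
  by split; rewrite // /other /= (negPf uv).
exists u; rewrite xE in sE d0 *; split=> //.
- by rewrite eq_sym.
- by rewrite sE /other /= (negPf uv).
- by move=> z; rewrite inc orbC.
- by split; rewrite // /other /= eqxx.
Qed.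

Definition peel_fields : seq nat := [:: vX; vY; DEG; SUM].

(** [Ex] holds at the vertices that may be left as leaves for a later call. Each removed edge spends
    its credit of 7, a test and six assignments; the credit of the edges in [A'] is handed back. *)
Lemma run_peel (Ex : pred 'I_n) (A : {set 'I_n * 'I_n}) M w b (x : 'I_n) (Q : post) :
  loopless A -> #|A| <= m -> alive A M -> M vX 0 = x ->
  (forall v, deg A v = 1 -> v = x \/ Ex v) ->
  (forall (A' : {set 'I_n * 'I_n}) M' b', peeled A A' -> alive A' M' -> (forall v, deg A' v = 1 -> Ex v) ->
     same peel_fields M M' -> b + 7 * #|A'| <= b' -> Q M' w b') ->
  run peel M w (b + 7 * #|A| + 1) Q.
Proof.
move=> noloop sA Mal MX Hx HQ; have [WN WB N2 dN] := word_bounds.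
pose I M' w' b' := exists (A' : {set 'I_n * 'I_n}) (x' : 'I_n),
  [/\ w' = w, peeled A A', alive A' M' /\ M' vX 0 = x',
      (forall v, deg A' v = 1 -> v = x' \/ Ex v) /\ same peel_fields M M'
    & b + 7 * #|A'| + 1 <= b'].
apply: (run_while (I := I)) => //; last first.
  by exists A, x; split=> //; apply: peeled_refl.
move=> M' w' b' [A' [x' [-> pA' [al' MX'] [Hx' sM'] lb]]].
have lx := ltn_ord x'; have [dx sx] := al' x'.
have [sA' _ _] := pA'.
have noloop' : loopless A' by move=> e /(subsetP sA')/noloop.
have cA' : #|A'| <= m := leq_trans (subset_leq_card sA') sA.
split; first by lia.
- by rewrite /= MX'; repeat split => //; (exact: bool_word || lia).
- rewrite /= MX' dx; case: (eqVneq (deg A' x') 1) => // d1 _.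
  have [e [y [eA xy sumy ince [oth d0]]]] := leaf_edge noloop' d1.
  have [dy sy] := al' y; have ly := ltn_ord y.
  have ye : incident y e by rewrite ince eqxx orbT.
  have xe : incident x' e by rewrite ince eqxx.
  have cA := cardsD1 e A'; rewrite eA add1n in cA.
  have pr v := deg_rem v eA; have prs v := nbr_sum_rem v eA.
  have yx : (y == x') = false by rewrite eq_sym; apply: negPf.
  have Edy := pr y; rewrite ye add1n in Edy.
  rewrite -dx in d1.
  apply: (@run_budget _ _ _ (b + 7 * #|A' :\ e| + 1 + 6)); first by lia.
  apply: (run_peel_step (x := x') (y := y) (d := deg (A' :\ e) y) (s := nbr_sum A' y)) => //.
  + by rewrite sx.
  + by rewrite dy.
  + by have := deg_le A' y; lia.
  + by apply: leq_trans (nbr_sum_le _ _) _; rewrite mulnCA leq_mul2l; lia.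
  + exists (A' :\ e), y; split=> //.
    * exact: peeled_trans pA' (peeled_leaf eA xe d0).
    * split=> // v; rewrite /peel_step /= !val_eqE.
      have := pr v; have := prs v; have [-> ->] := al' v; rewrite ince.
      case: (eqVneq v y) => [->|vy].
        by rewrite yx /= oth prs ye oth addKn.
      case: (eqVneq v x') => [->|vx] /=; last by rewrite !add0n => <- <-.
      by rewrite d0 (deg0_nbr_sum d0).
    * split; last first.
        by do 6![apply: same_upd => //].
      move=> v dv; case: (eqVneq v y) => [|vy]; [by left | right].
      case: (eqVneq v x') => [E|vx]; first by rewrite E d0 in dv.
      case: (Hx' v) => // [|E]; first by rewrite pr ince (negPf vx) (negPf vy) dv.
      by rewrite E eqxx in vx.
- rewrite /= MX' dx => d1; apply: (HQ A') => //.
    move=> v dv; case: (Hx' v dv) => // E; rewrite -E dv in d1.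
    by [].
  by lia.
Qed.

(** One pass over the vertices is enough: [peel] follows any leaf it creates, so a vertex already
    passed never remains a leaf. *)
Lemma run_peel_leaves (E : {set 'I_n * 'I_n}) M0 w b (Q : post) :
  loopless E -> #|E| <= m -> alive E M0 ->
  (forall (A : {set 'I_n * 'I_n}) M b', peeled E A -> core A -> alive A M -> same (vI :: peel_fields) M0 M ->
     b <= b' -> Q M w b') ->
  run peel_leaves M0 w (b + 7 * m + 4 * n + 2) Q.
Proof.
move=> noloop cE Mal HQ; have [WN WB N2 dN] := word_bounds.
have -> : b + 7 * m + 4 * n + 2 = b + 7 * m + 2 * n + 2 * n + 2 by lia.
pose I i M w' b' := exists (A : {set 'I_n * 'I_n}), [/\ w' = w, peeled E A /\ alive A M,
  (forall v, deg A v = 1 -> i <= v), same (vI :: peel_fields) M0 M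
  & b + 7 * #|A| + 2 * (n - i) <= b'].
apply: (@run_for I) => //; first by left.
- move=> i M w' b' lin Mi [A [-> [pA alA] Hi sM lb]].
  have [sA _ _] := pA.
  have cA : #|A| <= m := leq_trans (subset_leq_card sA) cE.
  apply: run_seq; apply: run_set => //=; rewrite ?Mi; try side.
  apply: (@run_budget _ _ _ (b + 2 * (n - i.+1) + 7 * #|A| + 1)); first by lia.
  apply: (run_peel (Ex := fun v : 'I_n => i < v) (x := Ordinal lin)) => //.
  + by move=> e /(subsetP sA)/noloop.
  + move=> v /Hi; rewrite leq_eqVlt => /predU1P[E1|]; last by right.
    by left; apply: val_inj.
  + move=> A' M' b'' pA' alA' Hi' sM' lb'; split; first by rewrite sM'.
    exists A'; split=> //; last by lia.
      by split; first exact: peeled_trans pA pA'.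
    apply: same_upd => //; apply: same_trans (same_weak _ sM').
      by apply: same_upd.
    by move=> k kf; rewrite inE kf orbT.
- exists E; split=> //.
  + by split; first exact: peeled_refl.
  + by apply: same_upd.
  + by rewrite subn0; lia.
- move=> M w' b' [A [-> [pA alA] Hi sM lb]]; apply: (HQ A) => //; last by lia.
  by move=> v; apply/eqP => /Hi; rewrite leqNgt ltn_ord.
Qed.

(** * Cutting edges and collecting suspects *)

Lemma run_cut_edge M w b (j t h dt dh st sh : nat) (Q : post) :
  M vJ 0 = j -> j < m -> M TAIL j = t -> M HEAD j = h -> t < n -> h < n -> t != h ->
  M DEG t = dt.+1 -> M DEG h = dh.+1 -> M SUM t = st -> M SUM h = sh ->
  dt < N -> dh < N -> st <= n * m -> sh <= n * m ->
  run (Seq peel (Seq (setv vX (HF HEAD (var vJ))) peel))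
    (upd (upd (upd (upd (upd (upd M SUSP t 1) DEG t dt) DEG h dh) SUM t (st - h))
      SUM h (sh - t)) vX 0 t) w b Q ->
  run cut_edge M w (b + 6) Q.
Proof.
move=> MJ jm Mt Mh tn hn /negPf th Mdt Mdh Mst Msh dtN dhN stm shm HQ.
have [WN WB N2 dN] := word_bounds.
have ht : (h == t) = false by rewrite eq_sym.
do 6![(apply: run_seq; apply: run_set) => //=;
  rewrite ?MJ ?Mt ?Mh ?ht ?th ?Mdt ?Mdh ?Mst ?Msh ?subn1 /=; try side].
by have -> : (b + 6).-2.-2.-2 = b by lia.
Qed.

Definition susp M : {set 'I_n} := [set v : 'I_n | M SUSP v != 0].

Definition cut_fields : seq nat := [:: vJ, SUSP & peel_fields].

Lemma suspP M (v : 'I_n) : (v \in susp M) = (M SUSP v != 0).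
Proof. by rewrite inE. Qed.

Lemma cut_alive (A : {set 'I_n * 'I_n}) M e : loopless A -> alive A M -> e \in A ->
  alive (A :\ e) (upd (upd (upd (upd (upd (upd M SUSP e.1 1) DEG e.1 (deg (A :\ e) e.1))
    DEG e.2 (deg (A :\ e) e.2)) SUM e.1 (nbr_sum A e.1 - e.2)) SUM e.2 (nbr_sum A e.2 - e.1))
    vX 0 e.1).
Proof.
move=> noloop alA eA v; rewrite /= !val_eqE.
have ne := noloop e eA; have := deg_rem v eA; have := nbr_sum_rem v eA.
have [-> ->] := alA v; rewrite /incident /other ![_ == v]eq_sym.
case: (eqVneq v e.2) => [v2|v2].
  rewrite -v2 in ne; rewrite v2 [e.2 == e.1]eq_sym -v2 (negPf ne) /= => -> _.
  by rewrite addKn.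
case: (eqVneq v e.1) => [->|v1] /=; first by move=> -> _; rewrite addKn.
by rewrite !add0n => -> ->.
Qed.

(** Deleting [e] from a core can create leaves only at the two ends of [e]. Peeling from the tail
    leaves the head as the only possible leaf, and the second peeling starts there. *)
Lemma run_cut (A : {set 'I_n * 'I_n}) M w b j (e : 'I_n * 'I_n) (Q : post) :
  loopless A -> #|A| <= m -> alive A M -> core A -> e \in A ->
  M vJ 0 = j -> j < m -> M TAIL j = e.1 -> M HEAD j = e.2 ->
  (forall (A' : {set 'I_n * 'I_n}) M' b', peeled (A :\ e) A' -> core A' -> alive A' M' ->
     same cut_fields M M' -> M' vJ 0 = j -> susp M' = e.1 |: susp M ->
     b + 7 * #|A'| <= b' -> Q M' w b') ->
  run cut_edge M w (b + 7 * #|A| + 2) Q.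
Proof.
move=> noloop cA alA coreA eA MJ jm Mt Mh HQ.
have [WN WB N2 dN] := word_bounds.
have [lt lh] := (ltn_ord e.1, ltn_ord e.2).
have [dt st] := alA e.1; have [dh sh] := alA e.2.
have th : e.1 != e.2 by apply: noloop.
have prt := deg_rem e.1 eA; have prh := deg_rem e.2 eA.
rewrite /incident eqxx add1n in prt; rewrite /incident eqxx orbT add1n in prh.
have cA1 : #|A| = #|A :\ e|.+1 by rewrite (cardsD1 e) eA.
have sA1 : A :\ e \subset A := subD1set A e.
have sumA v : nbr_sum A v <= n * m.
  by rewrite (leq_trans (nbr_sum_le _ _)) // leq_mul2l cA orbT.
have degA v : deg (A :\ e) v < N.
  by apply: leq_ltn_trans (deg_le _ _) _; rewrite dN; move: cA; rewrite cA1; clear; lia.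
(* The credit of [e] and the 2 extra commands pay for the six assignments of the cut, the second
   assignment to [vX] and the last tests of both peelings. *)
have Eb : b + 7 * #|A| + 2 = b + 1 + 1 + 7 * #|A :\ e| + 1 + 6 by rewrite cA1; clear; lia.
rewrite Eb; apply: (run_cut_edge (t := e.1) (h := e.2) MJ jm Mt Mh lt lh th _ _ st sh
    (dt := deg (A :\ e) e.1) (dh := deg (A :\ e) e.2)); rewrite ?dt ?dh //.
apply: run_seq.
have al1 := cut_alive noloop alA eA.
set M1 := upd _ vX 0 _ in al1 *.
have M1s : same cut_fields M M1 by rewrite /M1; do ![apply: same_upd => //].
have M1S : susp M1 = e.1 |: susp M.
  by apply/setP => v; rewrite !inE /M1 /= val_eqE; case: (eqVneq v e.1).
have M1J : M1 vJ 0 = j by rewrite /M1.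
have M1X : M1 vX 0 = e.1 by rewrite /M1.
clearbody M1.
have noloop1 : loopless (A :\ e) by move=> x /(subsetP sA1)/noloop.
have leaf v : deg (A :\ e) v = 1 -> v = e.1 \/ v == e.2.
  move=> d1; case: (eqVneq v e.2) => [|v2]; [by right | left].
  case: (eqVneq v e.1) => // v1; have := coreA v.
  by rewrite (deg_rem v eA) d1 /incident ![_ == v]eq_sym (negPf v1) (negPf v2).
have cA1m : #|A :\ e| <= m by apply: leq_trans cA; rewrite cA1.
apply: (run_peel (Ex := pred1 e.2) noloop1 cA1m al1 M1X leaf).
move=> A2 M2 b2 p2 al2 leaf2 s2 lb2.
have [sA2 _ _] := p2.
have M2J : M2 vJ 0 = j by rewrite s2.
have M2h : M2 HEAD j = e.2 by rewrite s2 // M1s.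
apply: run_seq; apply: run_set => //; rewrite /= ?M2J ?M2h.
- by move: lb2; clear; lia.
- by clear - N2; lia.
- by clear - jm dN N2; repeat split => //; lia.
have lb3 : b + 7 * #|A2| + 1 <= b2.-1 by move: lb2; clear; lia.
apply: (run_budget lb3).
have noloop2 : loopless A2 by move=> x /(subsetP sA2)/noloop1.
have cA2m : #|A2| <= m := leq_trans (subset_leq_card sA2) cA1m.
apply: (run_peel (Ex := pred0) (x := e.2) noloop2 cA2m) => //.
  by move=> v /leaf2/eqP->; left.
move=> A3 M3 b3 p3 al3 leaf3 s3 lb4.
apply: (HQ A3) => //.
- exact: peeled_trans p2 p3.
- by move=> v; apply/negP => /eqP/leaf3.
- apply: same_trans M1s (same_weak _ (same_trans s2 (same_trans _ s3))).
    by move=> k; rewrite !inE => /or4P[]->; rewrite ?orbT.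
  by apply: same_upd.
- by rewrite s3.
- by rewrite -M1S; apply/setP => v; rewrite !inE s3 //= s2.
Qed.

Lemma run_cut_edges (E S A0 : {set 'I_n * 'I_n}) L M0 w b (Q : post) :
  loopless E -> forest (E :\: S) -> uniq L -> (forall e, (e \in L) = (e \in E)) ->
  size L = m -> is_edge_list L M0 -> susp M0 = set0 -> peeled E A0 -> core A0 ->
  alive A0 M0 ->
  (forall M b', same cut_fields M0 M -> #|susp M| <= 3 * #|S| ->
     (forall C : {set 'I_n * 'I_n}, leafless C -> C \subset E -> C != set0 ->
        exists e, first_in L (susp M) C e) ->
     b <= b' -> Q M w b') ->
  run cut_edges M0 w (b + 13 * m + 2) Q.
Proof.
move=> noloop forE uL LE sL ML susp0 p0 core0 al0 HQ.
have [WN WB N2 dN] := word_bounds.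
have cE : #|E| = m by rewrite -sL -(card_uniqP uL); apply: eq_card => e; rewrite LE.
(* The [7 * m] is the initial credit, [4 * m] pays for two tests and the 2 extra commands of each
   cut, and the rest is loop overhead. *)
have -> : b + 13 * m + 2 = b + 7 * m + 4 * m + 2 * m + 2 by clear; lia.
pose I j M w' b' := exists A : {set 'I_n * 'I_n}, [/\ w' = w,
  cut_inv E S L j A (susp M), alive A M, same cut_fields M0 M
  & b + 7 * #|A| + 4 * (m - j) <= b'].
apply: (@run_for I) => //; first by right.
- move=> j M w' b' jm MJ [A [-> cI alA sM lb]].
  have jL : j < size L by rewrite sL.
  have [e [eL tk _ nx]] := size_nth jL; have [Mt Mh] := ML _ jL; rewrite !nx in Mt Mh.
  have eE : e \in E by rewrite -LE.
  have ej : index e L = j.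
    by have := nx _ e id; rewrite map_id => <-; rewrite index_uniq.
  have [[sA coreA] del _ _ _] := cI.
  have noloopA : loopless A by move=> x /(subsetP sA)/noloop.
  have cA : #|A| <= m by rewrite -cE subset_leq_card.
  have Mt' : M TAIL j = e.1 by rewrite sM.
  have Mh' : M HEAD j = e.2 by rewrite sM.
  have [lt lh] := (ltn_ord e.1, ltn_ord e.2).
  have [dt _] := alA e.1; have [dh _] := alA e.2.
  have skip b'' : e \notin A -> b'.-2 <= b'' ->
      run Skip M w b'' (fun M w b => M vJ 0 = j /\ I j.+1 (upd M vJ 0 j.+1) w b).
    move=> eA lb'; apply: run_skip; first by move: lb'; clear - lb jm; lia.
    split=> //; exists A; split=> //.
    - exact: cut_inv_skip tk eA cI.
    - by apply: same_upd.
    - by move: lb'; clear - lb jm; lia.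
  have jN : j < N by clear - dN jm; lia.
  have [ltN lhN] : e.1 < N /\ e.2 < N by clear - dN lt lh; lia.
  have b4 : 4 <= b' by clear - lb jm; lia.
  apply: run_if => //; rewrite /= ?MJ ?Mt' ?dt.
  - by clear - b4; lia.
  - by repeat split => //; clear - N2; lia.
  - move=> dt0; apply: run_if => //; rewrite /= ?MJ ?Mh' ?dh.
    + by clear - b4; lia.
    + by repeat split => //; clear - N2; lia.
    + move=> dh0.
      have eA : e \in A.
        case: (del e eE) => [|[//|d0|d0]]; first by rewrite in_take // ej ltnn.
          by rewrite d0 in dt0.
        by rewrite d0 in dh0.
      apply: (@run_budget _ _ _ (b + 4 * (m - j.+1) + 7 * #|A| + 2)).
        by clear - lb jm; lia.
      apply: (run_cut noloopA cA alA coreA eA MJ jm Mt' Mh').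
      move=> A3 M3 b3 p3 core3 al3 s3 M3J susp3 lb3; split=> //.
      exists A3; split=> //.
      * have -> : susp (upd M3 vJ 0 j.+1) = e.1 |: susp M by rewrite -susp3.
        exact: (cut_inv_cut noloop forE LE tk eA ej p3 core3 cI).
      * by apply: same_upd => //; apply: same_trans sM s3.
      * by clear - lb3; lia.
    + move=> d0; apply: skip; last by clear; lia.
      by apply/negP => eA; have := deg_gt0 eA (v := e.2); rewrite d0 /incident eqxx orbT => /(_ isT).
  - move=> d0; apply: skip; last by clear; lia.
    by apply/negP => eA; have := deg_gt0 eA (v := e.1); rewrite d0 /incident eqxx => /(_ isT).
- have [sA0 _ _] := p0; exists A0; split=> //.
  + have -> : susp (upd M0 vJ 0 0) = set0 by rewrite -susp0.
    exact: cut_inv0.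
  + by apply: same_upd.
  + by rewrite subn0 leq_add2r leq_add2l leq_mul2l -cE subset_leq_card.
- move=> M w' b' [A [-> cI alA sM lb]]; rewrite -sL in cI.
  have [cS Hll] := cut_inv_end LE cI; apply: HQ => //.
  by clear - lb; lia.
Qed.

(** * Searches from the suspects and the backward sweep *)

Section Search.
Variables (G : digraph 'I_n) (L : seq ('I_n * 'I_n)) (pos : 'I_n -> nat) (a : 'I_n -> R).
Hypotheses (topoL : topological G L pos) (sL : size L = m).
Import GRing.Theory.

(** The upper bound on the marks is carried along so that the value used by the next search is
    fresh. *)
Lemma run_mark M0 w b (v : 'I_n) (Q : post) :
  is_edge_list L M0 -> M0 vI 0 = v ->
  (forall u : 'I_n, (M0 MARK u == v.+1) = (u == v) /\ M0 MARK u <= v.+1) ->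
  (forall M b', same [:: vJ; MARK] M0 M ->
     (forall u : 'I_n, (M MARK u == v.+1) = connect (arc G) v u /\ M MARK u <= v.+1) ->
     b <= b' -> Q M w b') ->
  run mark_loop M0 w (b + 4 * m + 2) Q.
Proof.
move=> ML MI MK HQ; have [WN WB N2 dN] := word_bounds.
have -> : b + 4 * m + 2 = b + 2 * m + 2 * m + 2 by clear; lia.
pose I j M w' b' := [/\ w' = w, same [:: vJ; MARK] M0 M,
  forall u : 'I_n, (M MARK u == v.+1) = marked G L v j u /\ M MARK u <= v.+1
  & b + 2 * (m - j) <= b'].
have vn := ltn_ord v.
apply: (@run_for I) => //; first by right.
- move=> j M w' b' jm MJ [-> sM Hu lb].
  have jL : j < size L by rewrite sL.
  have [e [eL tk _ nx]] := size_nth jL; have [Mt Mh] := ML _ jL; rewrite !nx in Mt Mh.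
  have ej : index e L = j.
    have [uL _ _ _] := topoL.
    by have := nx _ e id; rewrite map_id => <-; rewrite index_uniq.
  have MI' : M vI 0 = v by rewrite sM.
  have Mt' : M TAIL j = e.1 by rewrite sM.
  have Mh' : M HEAD j = e.2 by rewrite sM.
  have [lt lh] := (ltn_ord e.1, ltn_ord e.2).
  have [jN vN] : j < N /\ v < N by clear - dN jm vn; lia.
  have [ltN lhN] : e.1 < N /\ e.2 < N by clear - dN lt lh; lia.
  have b2 : 2 <= b' by clear - lb jm; lia.
  have vW : v.+1 < W by clear - WN vN; lia.
  have Mtv : (M MARK e.1 == v.+1) = connect (arc G) v e.1.
    by rewrite (Hu e.1).1 -ej (marked_tail topoL).
  apply: run_if => //; rewrite /= ?MJ ?Mt' ?MI' ?addn1 ?Mtv.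
  + by clear - b2; lia.
  + by repeat split => //; (exact: bool_word || clear - N2; lia).
  + case: (boolP (connect (arc G) v e.1)) => // ve _.
    apply: run_set => //; rewrite /= ?MJ ?Mh' ?MI' ?addn1 //.
    * by clear - b2; lia.
    * by repeat split => //; clear - N2; lia.
    * by repeat split => //; clear - N2; lia.
    split=> //; split=> //.
    * by do 2!apply: same_upd => //.
    * move=> u; rewrite (markedS _ _ _ tk) ve /= val_eqE [e.2 == u]eq_sym.
      case: (eqVneq u e.2) => [_|_]; first by rewrite eqxx orbT.
      by rewrite orbF; apply: Hu.
    * by clear - lb jm; lia.
  + case: (boolP (connect (arc G) v e.1)) => // ve _.
    apply: run_skip; first by clear - b2; lia.
    split=> //; split=> //.
    * by apply: same_upd.
    * by move=> u; rewrite (markedS _ _ _ tk) (negPf ve) orbF; apply: Hu.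
    * by clear - lb jm; lia.
- split=> //.
  + by apply: same_upd.
  + by move=> u; rewrite marked0; apply: MK.
  + by rewrite subn0.
- move=> M w' b' [-> sM Hu lb]; apply: HQ => //.
    by move=> u; rewrite -(marked_all topoL) sL; apply: Hu.
  by clear - lb; lia.
Qed.

Lemma sum_below (P : pred 'I_n) j (jn : j < n) :
  (\sum_(u : 'I_n | (u < j.+1)%N && P u) a u =
   \sum_(u : 'I_n | (u < j)%N && P u) a u + (if P (Ordinal jn) then a (Ordinal jn) else 0))%R.
Proof.
pose z := Ordinal jn.
have E (u : 'I_n) : (u < j.+1) = (u == z) || (u < j) by rewrite ltnS leq_eqVlt.
case: ifP => Pz.
  rewrite (bigD1 z) /= ?ltnSn ?Pz // addrC; congr (_ + _)%R; apply: eq_bigl => u.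
  rewrite E; case: (eqVneq u z) => [->|_] /=; last by rewrite andbT.
  by rewrite ltnn andbF.
rewrite addr0; apply: eq_bigl => u; rewrite E.
by case: (eqVneq u z) => [->|_] //=; rewrite Pz andbF.
Qed.

Lemma run_sum M0 w b (v : 'I_n) (Q : post) :
  M0 vI 0 = v -> (forall u : 'I_n, (M0 MARK u == v.+1) = connect (arc G) v u) ->
  (forall u : 'I_n, w u = a u) -> w (n + v) = 0%R ->
  (forall M w' b', same [:: vJ] M0 M -> (forall z, z != n + v -> w' z = w z) ->
     w' (n + v) = reach_sum G a v -> b <= b' -> Q M w' b') ->
  run sum_loop M0 w (b + 4 * n + 2) Q.
Proof.
move=> MI MK wa w0 HQ; have [WN WB N2 dN] := word_bounds.
have -> : b + 4 * n + 2 = b + 2 * n + 2 * n + 2 by clear; lia.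
pose I j M w' b' := [/\ same [:: vJ] M0 M, forall z, z != n + v -> w' z = w z,
  (w' (n + v)%N = \sum_(u : 'I_n | (u < j)%N && connect (arc G) v u) a u)%R
  & b + 2 * (n - j) <= b'].
have vn := ltn_ord v.
apply: (@run_for I) => //; first by left.
- move=> j M w' b' jn MJ [sM wz wv lb].
  have MI' : M vI 0 = v by rewrite sM.
  have Mj : (M MARK j == v.+1) = connect (arc G) v (Ordinal jn).
    by rewrite sM // -(MK (Ordinal jn)).
  have [jN vN] : j < N /\ v < N by clear - dN jn vn; lia.
  have b2 : 2 <= b' by clear - lb jn; lia.
  have [vW [nvW nvN]] : v.+1 < W /\ n + v < W /\ n + v < 2 * N by clear - dN WN vN; lia.
  apply: run_if => //; rewrite /= ?MJ ?MI' ?addn1 ?Mj.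
  + by clear - b2; lia.
  + by repeat split => //; (exact: bool_word || clear - N2; lia).
  + case: (boolP (connect (arc G) v (Ordinal jn))) => // vj _.
    apply: run_wadd => //; rewrite /= ?MI' ?MJ //.
    * by clear - b2; lia.
    * by repeat split => //; clear - N2; lia.
    * by repeat split => //; clear - N2; lia.
    * by repeat split => //; clear - N2; lia.
    * by clear - jN; lia.
    split=> //; split=> /=.
    * by apply: same_upd.
    * by move=> z zv; rewrite (negPf zv) wz.
    * rewrite eqxx (sum_below _ jn) vj wv wz ?(wa (Ordinal jn)) //.
      by rewrite ltn_eqF // (leq_trans jn) // leq_addr.
    * by clear - lb jn; lia.
  + case: (boolP (connect (arc G) v (Ordinal jn))) => // vj _.
    apply: run_skip; first by clear - b2; lia.
    split=> //; split=> //.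
    * by apply: same_upd.
    * by rewrite (sum_below _ jn) (negPf vj) addr0.
    * by clear - lb jn; lia.
- split=> //.
  + by apply: same_upd.
  + by rewrite w0 big_pred0.
  + by rewrite subn0.
- move=> M w' b' [sM wz wv lb]; apply: HQ => //.
    rewrite wv; apply: eq_bigl => u; by rewrite ltn_ord inE.
  by clear - lb; lia.
Qed.

Lemma card_from (X : {set 'I_n}) i (lin : i < n) :
  #|[set u in X | i <= u]| = (Ordinal lin \in X) + #|[set u in X | i < u]|.
Proof.
rewrite (cardsD1 (Ordinal lin)) !inE leqnn andbT; congr (_ + _).
by apply: eq_card => u; rewrite !inE ltn_neqAle -val_eqE eq_sym /= andbCA.
Qed.

Lemma run_search_suspects (X : {set 'I_n}) M0 w b (Q : post) :
  is_edge_list L M0 -> (forall v, (v \in X) = (M0 SUSP v != 0)) ->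
  (forall v : 'I_n, M0 MARK v = 0) -> (forall u : 'I_n, w u = a u) ->
  (forall u : 'I_n, w (n + u) = 0%R) ->
  (forall M w' b', same [:: vI; vJ; MARK] M0 M -> (forall u : 'I_n, w' u = a u) ->
     (forall u : 'I_n, w' (n + u) = if u \in X then reach_sum G a u else 0%R) ->
     b <= b' -> Q M w' b') ->
  run search_suspects M0 w (b + 4 * n + (4 * m + 4 * n + 5) * #|X| + 2) Q.
Proof.
move=> ML MX M0m wa w0 HQ; have [WN WB N2 dN] := word_bounds.
(* The cost of one search: the initial mark, [4 * m + 2] for [mark_loop] and [4 * n + 2] for
   [sum_loop]. *)
set D := 4 * m + 4 * n + 5.
have -> : b + 4 * n + D * #|X| + 2 = b + 2 * n + D * #|X| + 2 * n + 2 by clear; lia.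
pose I i M w' b' := [/\ same [:: vI; vJ; MARK] M0 M, forall u : 'I_n, w' u = a u,
  forall u : 'I_n, w' (n + u) = if (u < i) && (u \in X) then reach_sum G a u else 0%R,
  forall u : 'I_n, M MARK u <= i
  & b + 2 * (n - i) + D * #|[set u in X | i <= u]| <= b'].
apply: (@run_for I) => //; first by left.
- move=> i M w' b' lin MI [sM wa' wn Mm]; rewrite (card_from X lin).
  pose v : 'I_n := Ordinal lin; rewrite -/v; set rest := #|_| => lb.
  have iN : i < N by clear - dN lin; lia.
  have b2 : 2 <= b' by clear - lb lin; lia.
  have Mv : (M SUSP i != 0) = (v \in X) by rewrite sM // MX.
  have ltS (u : 'I_n) : (u < i.+1) = (u == v) || (u < i) by rewrite ltnS leq_eqVlt.
  apply: run_if => //; rewrite /= ?MI.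
  + by clear - b2; lia.
  + by repeat split => //; clear - N2; lia.
  + rewrite Mv => vX; rewrite vX mulnDr muln1 in lb.
    have iW : i.+1 < W by clear - WN iN; lia.
    apply: run_seq; apply: run_set => //; rewrite /= ?MI ?addn1 //.
    * by clear - b2; lia.
    * by repeat split => //; clear - N2; lia.
    * by repeat split => //; clear - N2; lia.
    have lb1 : b + 2 * (n - i.+1) + D * rest + 4 * n + 2 + 4 * m + 2 <= b'.-2.
      by move: lb; rewrite /D; clear - lin; lia.
    apply: run_seq; apply: (run_budget lb1).
    apply: (run_mark (v := v)) => //=.
    - by move=> j /ML; rewrite /= !sM.
    - move=> u; case: (eqVneq (val u) i) => [E|ne].
        by rewrite eqxx leqnn; split=> //; apply/esym/eqP/val_inj.
      have le := Mm u; split; last by apply: leqW.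
      by rewrite ltn_eqF // -val_eqE (negPf ne).
    move=> M1 b1 s1 M1m lb2; apply: (run_budget lb2).
    have M1I : M1 vI 0 = v by rewrite s1.
    apply: (run_sum M1I) => //.
    - by move=> u; case: (M1m u).
    - by rewrite wn ltnn.
    move=> M2 w2 b3 s2 w2z w2v lb3; split; first by rewrite s2.
    split=> /=.
    * apply: same_upd => //; apply: same_trans sM (same_trans _ (same_weak _ s2)).
        apply: same_trans (same_weak _ s1); first by apply: same_upd.
        by move=> k; rewrite !inE => /orP[]->; rewrite ?orbT.
      by move=> k; rewrite !inE => ->; rewrite ?orbT.
    * move=> u; rewrite w2z // ltn_eqF //.
      by rewrite (leq_trans (ltn_ord u)) // leq_addr.
    * move=> u; rewrite ltS; case: (eqVneq u v) => [->|ne] /=; first by rewrite vX.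
      by rewrite w2z ?wn // eqn_add2l.
    * by move=> u; rewrite s2 //; case: (M1m u).
    * exact: lb3.
  + move=> /eqP; rewrite -[_ == _]negbK Mv => vX.
    rewrite (negPf vX) add0n in lb.
    apply: run_skip; first by clear - b2; lia.
    split=> //; split=> //=.
    * by apply: same_upd.
    * move=> u; rewrite ltS; case: (eqVneq u v) => [->|ne] //=.
      by have := wn v; rewrite ltnn (negPf vX).
    * by move=> u; apply: leqW.
    * by move: lb; rewrite -/rest; clear - lin; lia.
- split=> //.
  + by apply: same_upd.
  + by move=> u; rewrite /= M0m.
  + by rewrite subn0; apply: eq_leq; congr (_ + D * _); apply: eq_card => u; rewrite !inE leq0n andbT.
- move=> M w' b' [sM wa' wn _ lb]; apply: HQ => //.
    by move=> u; rewrite wn ltn_ord.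
  by clear - lb; lia.
Qed.


Lemma run_copy_sums (X : {set 'I_n}) M0 w b (Q : post) :
  (forall v, (v \in X) = (M0 SUSP v != 0)) -> (forall u : 'I_n, w u = a u) ->
  (forall u : 'I_n, w (n + u) = if u \in X then reach_sum G a u else 0%R) ->
  (forall M w' b', same [:: vI] M0 M ->
     (forall u : 'I_n, w' u = if u \in X then reach_sum G a u else a u) ->
     b <= b' -> Q M w' b') ->
  run copy_sums M0 w (b + 4 * n + 2) Q.
Proof.
move=> MX wa wn HQ; have [WN WB N2 dN] := word_bounds.
have -> : b + 4 * n + 2 = b + 2 * n + 2 * n + 2 by clear; lia.
pose I i M w' b' := [/\ same [:: vI] M0 M,
  forall u : 'I_n, w' u = if (u < i) && (u \in X) then reach_sum G a u else a u,
  forall u : 'I_n, w' (n + u) = w (n + u) & b + 2 * (n - i) <= b'].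
apply: (@run_for I) => //; first by left.
- move=> i M w' b' lin MI [sM wu wn' lb].
  pose v : 'I_n := Ordinal lin.
  have iN : i < N by clear - dN lin; lia.
  have b2 : 2 <= b' by clear - lb lin; lia.
  have [niW niN] : n + i < W /\ n + i < 2 * N by clear - dN WN iN; lia.
  have Mv : (M SUSP i != 0) = (v \in X) by rewrite sM // MX.
  have ltS (u : 'I_n) : (u < i.+1) = (u == v) || (u < i) by rewrite ltnS leq_eqVlt.
  apply: run_if => //; rewrite /= ?MI.
  + by clear - b2; lia.
  + by repeat split => //; clear - N2; lia.
  + rewrite Mv => vX; apply: run_wcopy => //; rewrite /= ?MI //.
    * by clear - b2; lia.
    * by repeat split => //; clear - N2; lia.
    * by clear - iN; lia.
    * by repeat split => //; clear - N2; lia.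
    split=> //; split=> //=.
    * by apply: same_upd.
    * move=> u; rewrite ltS; case: (eqVneq u v) => [->|ne] /=.
        by rewrite eqxx vX; have := wn' v; rewrite wn vX.
      by rewrite -(wu u); case: eqP => // E; case/eqP: ne; apply: val_inj.
    * move=> u; rewrite gtn_eqF ?wn' //.
      by rewrite (leq_trans lin) // leq_addr.
    * by clear - lb lin; lia.
  + move=> /eqP; rewrite -[_ == _]negbK Mv => vX.
    apply: run_skip; first by clear - b2; lia.
    split=> //; split=> //=.
    * by apply: same_upd.
    * move=> u; rewrite ltS wu; case: (eqVneq u v) => [->|ne] //=.
      by rewrite ltnn (negPf vX).
    * by clear - lb lin; lia.
- split=> //; first by apply: same_upd.
  by rewrite subn0.
- move=> M w' b' [sM wu wn' lb]; apply: HQ => //.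
    by move=> u; rewrite wu ltn_ord.
  by clear - lb; lia.
Qed.

Lemma run_sweep_back (X : {set 'I_n}) M0 w b (Q : post) :
  acyclic G -> is_edge_list L M0 -> (forall v, (v \in X) = (M0 SUSP v != 0)) ->
  (forall v x y u, v \notin X -> arc G v x -> arc G v y -> x != y ->
     connect (arc G) x u -> ~~ connect (arc G) y u) ->
  (forall u : 'I_n, w u = if u \in X then reach_sum G a u else a u) ->
  (forall M w' b', (forall u : 'I_n, w' u = reach_sum G a u) -> b <= b' -> Q M w' b') ->
  run sweep_back M0 w (b + 4 * m + 2) Q.
Proof.
move=> acG ML MX disj wu0 HQ; have [WN WB N2 dN] := word_bounds.
have [uL _ _ _] := topoL.
have rE v j : v \notin X -> (forall e, e \in take j L -> e.1 != v) ->
    (a v + \sum_(e <- drop j L | e.1 == v) reach_sum G a e.2 = reach_sum G a v)%R.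
  move=> vX noj; rewrite (out_sum topoL) // [RHS]reach_sum_disjoint //.
  by move=> x y u vx vy ne; apply: (disj v).
have mN : m < N by clear - dN; lia.
apply: run_seq; apply: run_set => //=.
- by clear; lia.
- by clear - N2; lia.
(* Partial sums are expressed by final values at the heads; this is sound because a head is complete
   before any edge into it is swept. *)
pose I M w' b' := exists j, [/\ M vJ 0 = j, j <= m, same [:: vJ] M0 M,
  (forall v : 'I_n, w' v = if v \in X then reach_sum G a v else
     a v + \sum_(e <- drop j L | e.1 == v) reach_sum G a e.2)%R
  & b + 4 * j + 1 <= b'].
apply: (run_while (I := I)) => //; last first.
  exists m; split=> //.
  - by apply: same_upd.
  - by move=> v; rewrite wu0 -sL drop_size big_nil addr0.
  - by clear; lia.
move=> M w' b' [j [MJ jm sM wv lb]]; rewrite /= MJ; split.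
- by clear - lb; lia.
- by repeat split => //; clear - N2; lia.
- case: j MJ jm wv lb => // j MJ jm wv lb _.
  have jL : j < size L by rewrite sL.
  have [e [eL tk dr nx]] := size_nth jL; have [Mt Mh] := ML _ jL; rewrite !nx in Mt Mh.
  have ej : index e L = j.
    by have := nx _ e id; rewrite map_id => <-; rewrite index_uniq.
  have [lt lh] := (ltn_ord e.1, ltn_ord e.2).
  have [ltN lhN] : e.1 < N /\ e.2 < N by clear - dN lt lh; lia.
  have jW : j < W by clear - dN WN jm; lia.
  have b4 : 4 <= b' by clear - lb; lia.
  have Mt' : M TAIL j = e.1 by rewrite sM.
  have Mh' : M HEAD j = e.2 by rewrite sM.
  have jN : j < N by clear - dN jm; lia.
  apply: run_seq; apply: run_set => //; rewrite /= ?MJ ?subn1 /=.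
  + by clear - b4; lia.
  + by clear - N2; lia.
  + by repeat split => //; clear - N2; lia.
  have s1 : same [:: vJ] M0 (upd M vJ 0 j) by apply: same_upd.
  (* The edges out of the head come after [e] in [L], so all of them have already been swept. *)
  have wh : w' e.2 = reach_sum G a e.2.
    rewrite wv; case: (boolP (e.2 \in X)) => // hX; apply: rE => //.
    move=> e' e't; apply/eqP => E.
    have e'L := mem_take e't.
    have := in_out_lt topoL eL e'L (esym E); rewrite ej ltnNge.
    by move: e't; rewrite in_take // ltnS => ->.
  have Mst : (M SUSP e.1 != 0) = (e.1 \in X) by rewrite sM // MX.
  apply: run_if => //; rewrite /= ?MJ ?Mt' //.
  + by clear - b4; lia.
  + by repeat split => //; clear - N2; lia.
  + rewrite Mst => tX; apply: run_skip; first by clear - b4; lia.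
    exists j; split=> //; first exact: ltnW.
      move=> v; rewrite wv dr big_cons; case: eqP => // <-.
      by rewrite tX.
    by clear - lb; lia.
  + move=> /eqP; rewrite -[_ == _]negbK Mst => tX.
    apply: run_wadd => //; rewrite /= ?Mt' ?Mh' //.
    * by clear - b4; lia.
    * by repeat split => //; clear - N2; lia.
    * by clear - ltN; lia.
    * by repeat split => //; clear - N2; lia.
    * by clear - ltN; lia.
    * by repeat split => //; clear - N2; lia.
    * by clear - lhN; lia.
    exists j; split=> //=; first exact: ltnW.
      move=> v; rewrite val_eqE dr big_cons wh eq_sym.
      case: (eqVneq e.1 v) => [<-|ne]; last exact: wv.
      by rewrite wv (negPf tX) -addrA [(_ + reach_sum _ _ _)%R]addrC.
    by clear - lb; lia.
- move=> j0; apply: HQ; last by clear - lb; lia.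
  move=> v; rewrite wv j0; case: (boolP (v \in X)) => // vX.
  by apply: rE => // e; rewrite take0.
Qed.

End Search.

(** * Composition of the phases *)

Lemma kahn_topological (G : digraph 'I_n) (q : seq 'I_n) L :
  (forall x y, ((x, y) \in es) = arc G x y) -> kahn_inv es q L -> perm_eq L es ->
  topological G L (index^~ q).
Proof.
move=> esG [_ [uL _] _ Lord Lsort] pL; split=> //.
- by move=> x y; rewrite (perm_mem pL).
- by move=> x y xy; have [] := Lord (x, y); rewrite // (perm_mem pL) esG.
- move=> e e' eL e'L le; set s := [seq index x.1 q | x <- L] in Lsort.
  have st : sorted leq s by rewrite (sorted_pairwise leq_trans).
  have E x : x \in L -> index x.1 q = nth 0 s (index x L).
    by move=> xL; rewrite (nth_map x) ?index_mem // nth_index.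
  by rewrite (E e) // (E e') // (sorted_leq_nth leq_trans leqnn) // inE size_map index_mem.
Qed.

Lemma same_edge_list fs (L : seq ('I_n * 'I_n)) M M' :
  TAIL \notin fs -> HEAD \notin fs -> same fs M M' -> is_edge_list L M -> is_edge_list L M'.
Proof. by move=> h1 h2 sM ML p /ML; rewrite !sM. Qed.

Lemma listing_alive (G : digraph 'I_n) M : perm_eq es (enum (edges G)) ->
  (forall v : 'I_n, M DEG v = degs es v /\ M SUM v = sums es v) -> alive (edges G) M.
Proof.
move=> pes Mv v; have [-> ->] := Mv v.
by rewrite /degs /sums !(perm_big _ pes) /= big_enum big_enum_cond.
Qed.

Lemma run_program (G : digraph 'I_n) (a : 'I_n -> R) (S : {set 'I_n * 'I_n}) M0 w b (Q : post) :
  acyclic G -> perm_eq es (enum (edges G)) -> forest (edges G :\: S) ->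
  (forall k i, M0 k i = 0) -> (forall u : 'I_n, w u = a u) ->
  (forall u : 'I_n, w (n + u) = 0%R) ->
  (forall M w' b', (forall u : 'I_n, w' u = reach_sum G a u) -> Q M w' b') ->
  44 * m + 22 * n + 18 + (4 * m + 4 * n + 5) * (3 * #|S|) <= b ->
  run reachability_program M0 w b Q.
Proof.
move=> acG pes forS M00 wa w0 HQ leb.
have ues : uniq es by rewrite (perm_uniq pes) enum_uniq.
have esE e : (e \in es) = (e \in edges G) by rewrite (perm_mem pes) mem_enum.
have esG x y : ((x, y) \in es) = arc G x y by rewrite esE inE.
have noloop : loopless (edges G).
  by move=> [x y]; rewrite inE /=; apply: contraTneq => ->; rewrite (arc_irrefl G).
have cE : #|edges G| = m by rewrite -(card_uniqP ues); apply: eq_card => e; rewrite esE.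
set D := 4 * m + 4 * n + 5 in leb.
(* Budgets are added up from the last phase backwards: each is what must still be available when its
   phase begins. *)
pose b7 := 4 * m + 2; pose b6 := b7 + 4 * n + 2.
pose b5 := b6 + 4 * n + D * (3 * #|S|) + 2.
pose b4 := b5 + 13 * m + 2; pose b3 := b4 + 7 * m + 4 * n + 2.
pose b2 := b3 + 5 * n + 11 * m + 3; pose b1 := b2 + 5 * n + 3.
have {}leb : b1 + 9 * m + 2 <= b.
  by move: leb; rewrite /b1 /b2 /b3 /b4 /b5 /b6 /b7; set x := D * _; clear; lia.
apply: run_seq; apply: (run_budget leb); apply: run_scan_edges => //.
  by move=> e; rewrite esE; apply: noloop.
move=> M1 [s1 F1 X1 V1]; rewrite take_size in V1.
apply: run_seq; apply: run_enqueue_sources; first by move=> v; case: (V1 v).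
move=> q0 M2 c2 lc2 uq0 q0P M2q s2.
apply: run_seq; apply: (run_budget lc2); apply: (run_sort_edges acG esG ues _ uq0 M2q q0P).
- split=> [v|e em]; first by rewrite s2.
  by rewrite s2 // X1.
- by move=> v; rewrite s2 //; case: (V1 v).
move=> q L M3 c3 lc3 kinv pL M3L s3.
have topoL := kahn_topological esG kinv pL.
have sL : size L = m by apply: perm_size.
have LE e : (e \in L) = (e \in edges G) by rewrite (perm_mem pL) esE.
have [uL _ _ _] := topoL.
apply: run_seq; apply: (run_budget lc3); apply: (run_peel_leaves noloop); first by rewrite cE.
  apply: listing_alive pes _ => v; rewrite !s3 // !s2 //.
  by case: (V1 v).
move=> A M4 c4 pA coreA alA s4 lc4.
apply: run_seq; apply: (run_budget lc4).
apply: (run_cut_edges noloop forS uL LE sL _ _ pA coreA alA).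
- exact: same_edge_list s4 M3L.
- by apply/setP => v; rewrite !inE s4 // s3 // s2 // s1 // M00.
move=> M5 c5 s5 cX Hll lc5.
have M5L : is_edge_list L M5.
  by apply: same_edge_list s5 _ => //; apply: same_edge_list s4 M3L.
have disj := susp_disjoint topoL acG Hll.
have le5 : b6 + 4 * n + D * #|susp M5| + 2 <= c5.
  apply: leq_trans lc5; rewrite /b5 leq_add2r leq_add2l.
  by rewrite leq_mul2l cX orbT.
apply: run_seq; apply: (run_budget le5).
apply: (run_search_suspects topoL sL (a := a) (X := susp M5)) => //.
- by move=> v; rewrite suspP.
- by move=> v; rewrite s5 // s4 // s3 // s2 // s1 // M00.
move=> M6 w6 c6 s6 w6a w6n lc6.
have M6S v : (v \in susp M5) = (M6 SUSP v != 0) by rewrite s6 // suspP.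
apply: run_seq; apply: (run_budget lc6).
apply: (run_copy_sums (G := G) (a := a) M6S w6a w6n).
move=> M7 w7 c7 s7 w7a lc7; apply: (run_budget lc7).
have M7S v : (v \in susp M5) = (M7 SUSP v != 0) by rewrite s7 // M6S.
apply: (run_sweep_back topoL sL (a := a) (b := 0) acG _ M7S disj w7a).
  by apply: same_edge_list s7 _ => //; apply: same_edge_list s6 _.
by move=> M8 w8 c8 w8r _; apply: HQ.
Qed.

End Logic.

(** * The initial memory and the final bounds *)

Lemma nth_input (n : nat) (es : seq ('I_n * 'I_n)) i :
  let s := flatten [seq [:: val e.1; val e.2] | e <- es] in
  [/\ nth 0 s (2 * i) = tl es i, nth 0 s (2 * i).+1 = hd es i & size s = 2 * size es].
Proof.
elim: es i => [|e es IH] i /=; first by rewrite !nth_nil /tl /hd !nth_nil.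
case: i => [|i].
  by have [_ _ ->] := IH 0; rewrite /tl /hd /= mulnS.
by have [h1 h2 ->] := IH i; rewrite mulnS /= h1 h2 mulnS.
Qed.

Lemma rep_input (R : zmodType) (n : nat) (es : seq ('I_n * 'I_n)) (a : 'I_n -> R) :
  rep es (fun _ _ => 0) (wmem (input es a)) (input es a).
Proof.
split=> // [i im|k i kK].
  by have [h1 h2 _] := nth_input es i; rewrite /= h1 h2.
rewrite /input [LHS]nth_default //=.
by have [_ _ ->] := nth_input es 0; lia.
Qed.

(* The program p and the constants C, k do not depend on the input; words have
   O(log (n + m)) bits, i.e. values below (n + m + 2) ^ k. *)
Theorem theorem1 (R : realType) :
  exists (p : cmd) (C k : nat),
    forall (n : nat) (G : digraph 'I_n) (a : 'I_n -> R)
      (es : seq ('I_n * 'I_n)) (f : nat),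
      acyclic G -> edge_listing G es -> is_feedback_edge_number G f ->
      let m := #|edges G| in
      exists (space time : nat) (final : state R),
        [/\ exec ((n + m + 2) ^ k) space p (input es a) time final,
            forall v : 'I_n, wmem final v = (\sum_(u in reach G v) a u)%R,
            time <= C * time_bound f n m
          & space <= C * space_bound f n m].
Proof.
exists reachability_program, (80 * unit_cost), 8 => n G a es f acG pes [[S [sS forS] <-] _] m.
have sm : size es = m by rewrite (perm_size pes) -cardE.
pose N := n + m + 2.
have defN : N = n + size es + 2 by rewrite sm.
have leW : 64 * (N * N) <= N ^ 8.
  (* Since [N >= 2], the factor [64 = 2 ^ 6] is at most [N ^ 6]. *)
  rewrite (_ : 8 = 6 + 2) // expnD -mulnn leq_mul2r.
  by rewrite (_ : 64 = 2 ^ 6) // leq_exp2r ?orbT // /N addn2.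
pose b := 44 * m + 22 * n + 18 + (4 * m + 4 * n + 5) * (3 * #|S|).
have wa (u : 'I_n) : wmem (input es a) u = a u.
  by rewrite /= (nth_map u) ?size_enum_ord // nth_ord_enum.
have w0 (u : 'I_n) : wmem (input es a) (n + u) = 0%R.
  by rewrite /= nth_default // size_map size_enum_ord leq_addr.
have leb : 44 * size es + 22 * n + 18 + (4 * size es + 4 * n + 5) * (3 * #|S|) <= b.
  by rewrite sm.
have [t [s [M [w [b' [ex [_ _ _ sw] tb wr]]]]]] :=
  run_program (M0 := fun _ _ => 0) (Q := fun _ w _ => forall u : 'I_n, w u = reach_sum G a u)
    defN leW acG pes forS (fun _ _ => erefl) wa w0 (fun _ _ _ h => h) leb (rep_input es a).
exists (2 * size es + 2 + stride * N), t, s; split.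
- exact: ex.
- by move=> v; rewrite sw wr.
(* This absorbs the stray term [15 * #|S|] into a multiple of [m]. The coefficients become 71 for
   the term in [m], 34 for the term in [n] and 18 for the constant, all below 80. *)
- have cS : #|S| <= m by apply: subset_leq_card.
  have tub : t <= unit_cost * b by apply: leq_trans tb; apply: leq_addr.
  apply: leq_trans tub _; rewrite [80 * _]mulnC -mulnA leq_mul2l /=.
  rewrite /b /time_bound; move: cS; set F := maxn _ 1.
  have F1 : 1 <= F by apply: leq_maxr.
  have : #|S| <= F by apply: leq_maxl.
  move: #|S| => c cF cm.
  have F2 : F <= F ^ 2 by rewrite -mulnn leq_pmull.
  have F3 : F <= F ^ 3 by rewrite expnS leq_pmulr // expn_gt0 F1.
  have h1 : m <= F ^ 2 * m by rewrite leq_pmull // expn_gt0 F1.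
  have h2 : n <= F ^ 3 * n by rewrite leq_pmull // expn_gt0 F1.
  have h3 : c * m <= F ^ 2 * m by rewrite leq_mul2r (leq_trans cF F2) orbT.
  have h4 : c * n <= F ^ 3 * n by rewrite leq_mul2r (leq_trans cF F3) orbT.
  have -> : (4 * m + 4 * n + 5) * (3 * c) = 12 * (c * m) + 12 * (c * n) + 15 * c.
    by clear; lia.
  by move: (F ^ 3 * n) (F ^ 2 * m) (c * m) (c * n) h1 h2 h3 h4 cm; clear; lia.
- have h : n <= maxn #|S| 1 * n by rewrite leq_pmull // leq_maxr.
  rewrite /space_bound sm /stride /unit_cost /N.
  by move: (maxn _ _ * n) h; clear; lia.
Qed.
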